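(* Let $\nu$ be an admissible profile and let $$p_0 := \min\Big(1,\ \inf_{\alpha:\,0\le\nu(\alpha)<1}\underline{\partial}^+\nu(\alpha)\Big).$$ Then $S^\nu$ is reflexive if and only if $p_0=1$.
   Context: Let $\mathbb{N}_0=\{0,1,2,\dots\}$, $\Lambda=\bigcup_{j\in\mathbb{N}_0}\{j\}\times\{0,\dots,2^j-1\}$ and $\Omega=\mathbb{C}^\Lambda$. An admissible profile is a non-decreasing right-continuous function $\nu:\mathbb{R}\to\{-\infty\}\cup[0,1]$ that is not identically $-\infty$. The asymptotic profile of $x\in\Omega$ is $\nu_x(\alpha)=\lim_{\varepsilon\to0^+}\limsup_{j\to\infty}\frac{\log \#\{k:|x_{j,k}|\ge 2^{-(\alpha+\varepsilon)j}\}}{\log(2^j)}$ (with $\log 0=-\infty$), and $S^\nu=\{x\in\Omega:\nu_x(\alpha)\le\nu(\alpha)\ \forall\alpha\in\mathbb{R}\}$, which is a vector space. For $\alpha\in\mathbb{R}$ and $\beta\in\{-\infty\}\cup[0,+\infty)$ let $d_{\alpha,\beta}(x,y)=d_{\alpha,\beta}(x-y)$ with $d_{\alpha,\beta}(x)=\inf\{C\ge0:\ \forall j\in\mathbb{N}_0,\ \#\{k:|x_{j,k}|\ge C2^{-\alpha j}\}\le C2^{\beta j}\}$ (with $2^{\beta j}:=0$ if $\beta=-\infty$), and let $E(\alpha,\beta)=\{x\in\Omega:d_{\alpha,\beta}(x)<\infty\}$ with the metric $d_{\alpha,\beta}$. For any sequence $(\alpha_n)$ dense in $\mathbb{R}$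 and any sequence $\varepsilon_m\searrow0$ of positive reals, $S^\nu=\bigcap_{n,m}E(\alpha_n,\nu(\alpha_n)+\varepsilon_m)$, and the topology of $S^\nu$ is the coarsest topology making all inclusions $S^\nu\subset E(\alpha_n,\nu(\alpha_n)+\varepsilon_m)$ continuous. It is known that this topology does not depend on the choice of these sequences and makes $S^\nu$ a complete metrizable topological vector space. The right-inf derivative, where $\nu(\alpha)>-\infty$, is $\underline{\partial}^+\nu(\alpha)=\liminf_{h\to0^+}\frac{\nu(\alpha+h)-\nu(\alpha)}{h}$. Convention: $\inf\emptyset=+\infty$. A topological vector space is reflexive if it is a (Hausdorff) locally convex space and the canonical map into its strong bidual is a topological isomorphism; in particular a reflexive space is by definition locally convex. *)

(* Defs.v *)
From HB Require Import structures.
From mathcomp Require Import all_boot all_order all_algebra.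
From mathcomp Require Import all_classical all_reals all_analysis.
From mathcomp Require Import complex.
Set Implicit Arguments.
Unset Strict Implicit.
Unset Printing Implicit Defensive.
Import Order.TTheory GRing.Theory Num.Theory.
Import numFieldNormedType.Exports.
Import ComplexField.Normc.
Local Open Scope classical_set_scope.
Local Open Scope ring_scope.

Section strong_dual.
Context {K : numFieldType}.
Implicit Type E : preTopologicalLmodType K.

(* Von Neumann boundedness: B is absorbed by every neighbourhood of 0. *)
Definition vN_bounded E : set (set E) :=
  [set B | forall U : set E, nbhs 0 U -> exists2 r : K, 0 < r &
    forall t : K, r <= `|t| -> B `<=` [set t *: u | u in U]].

Definition continuous_form E : set (E -> K^o) :=
  [set f | linear f /\ continuous f].

Lemma continuous_form_submod E :
  GRing.submod_closed (fun f => f \in @continuous_form E).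
Proof.
split.
  apply/mem_set; split; last by move=> x; exact: cvg_cst.
  by move=> a u v; rewrite /= scaler0 addr0.
move=> a f g /set_mem[lf cf] /set_mem[lg cg]; apply/mem_set; split.
  move=> b u v; rewrite !fctE lf lg scalerDr addrACA; congr (_ + _).
  by rewrite scalerDr !scalerA mulrC.
move=> x; apply: cvgD; last exact: cg.
by apply: cvgZr; exact: cf.
Qed.

Definition strong_dual E : Type := {f : E -> K^o | f \in @continuous_form E}.

HB.instance Definition _ E := SubChoice.on (strong_dual E).
HB.instance Definition _ E := GRing.SubChoice_isSubLmodule.Build
  K (E -> K^o) (fun f => f \in @continuous_form E) (strong_dual E)
  (GRing.submod_closed_semi (@continuous_form_submod E)).
(* The strong topology: uniform convergence on the bounded subsets of E. *)
HB.instance Definition _ E := Topological.copy (strong_dual E)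
  (initial_topology (val : strong_dual E -> {family @vN_bounded E, E -> K^o})).
End strong_dual.

Section reflexive.
Context {K : numFieldType}.
Variable E : topologicalLmodType K.

Lemma vN_bounded1 (x : E) : vN_bounded [set x].
Proof.
move=> U U0.
have /= := @scale_continuous K E (0, x) U; rewrite scale0r => /(_ U0).
case=> -[A B] /= [] /nbhs_ballP[d /= d0 dA] Bx ABU.
exists (2 / d); first by rewrite divr_gt0.
move=> t dt _ ->; exists (t^-1 *: x); last first.
  rewrite scalerA divff ?scale1r// -normr_gt0.
  by rewrite (lt_le_trans _ dt)// divr_gt0.
apply: (ABU (t^-1, x)); split => /=; last exact: nbhs_singleton.
have t0 : 0 < `|t| by rewrite (lt_le_trans _ dt)// divr_gt0.
apply: dA; rewrite /ball/= sub0r normrN normfV.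
rewrite invf_plt ?posrE// (lt_le_trans _ dt)// ltr_pdivlMr//.
by rewrite mulVf ?gt_eqF// ltr1n.
Qed.

Lemma evaluation_continuous_form (x : E) :
  (fun f : strong_dual E => val f x : K^o) \in @continuous_form K (strong_dual E).
Proof.
apply/mem_set; split; first by [].
move=> f.
have : (val : strong_dual E -> {family @vN_bounded K E, E -> K^o}) @ f
    --> (val f : {family @vN_bounded K E, E -> K^o}).
  exact: initial_continuous.
move=> /fam_cvgP /(_ _ (@vN_bounded1 x)).
rewrite (@uniform_set1 E K^o _ _ x (fmap_filter _ (nbhs_filter f))).
by apply; apply: fmap_filter; exact: nbhs_filter.
Qed.

(* The canonical map of E into its strong bidual. *)
Definition evaluation (x : E) : strong_dual (strong_dual E) :=
  exist (fun phi => phi \in _) (fun f => val f x) (evaluation_continuous_form x).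

Lemma evaluation_linear : linear evaluation.
Proof.
move=> a x y; apply/val_inj/funext => f /=.
by have /set_mem[lf _] := valP f; exact: lf.
Qed.

(* The second component is the local convexity axiom of tvsType. *)
Definition locally_convex_space : Prop :=
  hausdorff_space E /\
  exists2 B : set_system E, (forall b, b \in B -> convex_set b) & basis B.

Definition reflexive_tvs : Prop :=
  [/\ locally_convex_space, bijective evaluation, continuous evaluation &
      forall A, open A -> open [set evaluation x | x in A]].

End reflexive.

Section sequence_space.
Context {R : realType}.

Definition wavelet_index : Type := {j : nat & 'I_(2 ^ j)}.

Definition Omega : Type := wavelet_index -> R[i]^o.

HB.instance Definition _ := GRing.Lmodule.on Omega.

Definition large_count (x : Omega) (j : nat) (t : R) : nat :=
  #|[pred k : 'I_(2 ^ j) | t <= normc (x (existT _ j k))]|.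

Implicit Types (x y : Omega) (j : nat) (t a e C : R) (b : \bar R).

Lemma normc_ge0 (z : R[i]) : 0 <= normc z.
Proof. by case: z => u v; exact: sqrtr_ge0. Qed.

Lemma large_count_le x j t t' :
  t <= t' -> (large_count x j t' <= large_count x j t)%N.
Proof.
move=> tt'; apply: subset_leq_card; apply/fintype.subsetP => k.
by rewrite !inE; exact: le_trans.
Qed.

Lemma large_countD x y j t t' : (large_count (x + y)%R j (t + t')%R <=
  large_count x j t + large_count y j t')%N.
Proof.
rewrite /large_count -cardUI; apply: (leq_trans _ (leq_addr _ _)).
apply: subset_leq_card; apply/fintype.subsetP => k; rewrite !inE !fctE => txy.
rewrite -implyNb -ltNge; apply/implyP => xt; rewrite leNgt; apply/negP => yt.
move: txy; rewrite leNgt => /negP; apply.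
by rewrite (le_lt_trans (le_normcD _ _))// ltrD.
Qed.

Lemma large_countZ (l : R[i]) x j t M : 0 < M -> normc l <= M ->
  (large_count (l *: x)%R j t <= large_count x j (t / M)%R)%N.
Proof.
move=> M0 lM; apply: subset_leq_card; apply/fintype.subsetP => k; rewrite !inE.
rewrite ler_pdivrMr// => /le_trans; apply.
rewrite fctE [X in normc X](_ : _ = l * x (existT _ j k))// normcM mulrC.
by rewrite ler_wpM2l//; exact: normc_ge0.
Qed.

Lemma large_countN x j t : large_count (- x) j t = large_count x j t.
Proof. by apply: eq_card => k; rewrite !inE fctE normcN. Qed.

Lemma large_count_eq0 x j t : (forall k, normc (x (existT _ j k)) < t) ->
  large_count x j t = 0%N.
Proof.
by move=> xt; apply: eq_card0 => k; rewrite !inE leNgt xt.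
Qed.

Lemma large_count0 j t : 0 < t -> large_count 0 j t = 0%N.
Proof. by move=> t0; apply: large_count_eq0 => k; rewrite normc0. Qed.

(* 2 ^ (b j), with value 0 at every j, including j = 0, when b = -oo; the
   value +oo only makes the function total. *)
Definition powe2 b (j : nat) : \bar R :=
  match b with
  | r%:E => (2 `^ (r * j%:R))%:E
  | +oo => +oo
  | -oo => 0
  end%E.

Lemma powe2_ge0 b j : (0 <= powe2 b j)%E.
Proof. by case: b => [r| |]//=; rewrite lee_fin powR_ge0. Qed.

Lemma powe2D b e j : powe2 (b + e%:E)%E j = (powe2 b j * (2 `^ (e * j%:R))%:E)%E.
Proof.
case: b => [r| |] /=; last by rewrite mul0e.
  by rewrite mulrDl powRD -?EFinM// pnatr_eq0 implybT.
by rewrite gt0_mulye// lte_fin powR_gt0.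
Qed.

(* lne 0 = -oo; the denominator vanishes at j = 0, which is irrelevant for the
   superior limit. *)
Definition growth_rate x a e : \bar R :=
  limn_esup (fun j => lne (large_count x j (2 `^ (- (a + e) * j%:R)))%:R%:E
                      / (ln (2 ^+ j))%:E)%E.

Definition asymptotic_profile x a : \bar R :=
  lim (growth_rate x a e @[e --> 0^'+]).

Lemma log_ratio_le (N : nat) j b : (0 < j)%N ->
  (lne N%:R%:E / (ln (2 ^+ j))%:E <= b)%E = (N%:R%:E <= powe2 b j)%E.
Proof.
move=> j0; have ln0 : 0 < ln (2 ^+ j) :> R.
  by rewrite ln_gt0// exprn_egt1 ?ltr1n// -lt0n.
rewrite inver gt_eqF//; case: N => [|N].
  by rewrite /= lexx gt0_mulNye ?leNye ?powe2_ge0// lte_fin invr_gt0.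
have N0 : (0 : R) < N.+1%:R by rewrite ltr0n.
rewrite lne_EFin// -EFinM; case: b => [r| |] /=.
- rewrite !lee_fin ler_pdivrMr//.
  rewrite (_ : r * ln (2 ^+ j) = ln (2 `^ (r * j%:R))); last first.
    by rewrite ln_powR lnXn// -[ln 2 *+ j]mulr_natl mulrA.
  by rewrite ler_ln ?posrE ?powR_gt0.
- by rewrite !leey.
- by rewrite leeNy_eq lee_fin lt_geF.
Qed.

Lemma growth_rate_nd x a : nondecreasing_fun (growth_rate x a).
Proof.
move=> e e' ee'; apply: le_ereal_inf_tmp => _ [V FV <-].
apply: ge_ereal_inf; eexists; first by exists V.
apply: ge_ereal_sup => _ [j Vj <-].
apply: (le_trans _ (ereal_sup_ubound _)); last by exists j.
case: j {Vj} => [|j].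
  rewrite expr0 ln1 !mulr0 powRr0; exact: lexx.
rewrite log_ratio_le//; apply: (@le_trans _ _ (large_count x j.+1 (2 `^ (- (a + e') * j.+1%:R)))%:R%:E).
  rewrite lee_fin ler_nat; apply: large_count_le.
  by apply: ler_powR; rewrite ?ler1n// ler_wpM2r// lerN2 lerD2l.
by rewrite -log_ratio_le.
Qed.

Lemma asymptotic_profileE x a : asymptotic_profile x a =
  ereal_inf [set growth_rate x a e | e in `]0, +oo[%classic].
Proof.
apply: cvg_lim; first exact: ereal_hausdorff.
have H : {in `]0, +oo[ &, nondecreasing_fun (growth_rate x a)}.
  by move=> u v _ _; exact: growth_rate_nd.
have b0 : (BRight (0 : R) < +oo)%O by [].
exact: (nondecreasing_at_right_cvge _ b0 H).
Qed.

Lemma asymptotic_profile_leP x a b : (asymptotic_profile x a <= b)%E <->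
  forall d : R, 0 < d -> exists2 e : R, 0 < e & \forall j \near \oo,
    ((large_count x j (2 `^ (- (a + e) * j%:R)))%:R%:E
       <= powe2 (b + d%:E) j)%E.
Proof.
rewrite asymptotic_profileE; split=> [ltb d d0|H].
  case: b ltb => [r| |] /= ltb.
  - have : (ereal_inf [set growth_rate x a e | e in `]0%R, +oo[%classic]
        < r%:E + d%:E)%E by rewrite (le_lt_trans ltb)// lteDl.
    move=> /ereal_inf_lt[_ [e /= + <-]]; rewrite in_itv/= andbT => e0.
    move=> /ereal_inf_lt[_ [V FV <-]] Vlt; exists e => //; near=> j.
    rewrite -/(powe2 (r + d)%:E j) -log_ratio_le; last by near: j; exists 1%N.
    apply/ltW/(le_lt_trans _ Vlt); apply: ereal_sup_ubound; exists j => //.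
    by near: j.
  - by exists 1 => //; near=> j; rewrite leey.
  - have : (ereal_inf [set growth_rate x a e | e in `]0%R, +oo[%classic]
        < (-1)%:E)%E by rewrite (le_lt_trans ltb)// ltNyr.
    move=> /ereal_inf_lt[_ [e /= + <-]]; rewrite in_itv/= andbT => e0.
    move=> /ereal_inf_lt[_ [V FV <-]] Vlt; exists e => //; near=> j.
    have j0 : (0 < j)%N by near: j; exists 1%N.
    set N := large_count _ _ _.
    have : (lne (N%:R : R)%:E / (ln (2 ^+ j))%:E <= (-1)%:E)%E.
      apply/ltW/(le_lt_trans _ Vlt); apply: ereal_sup_ubound; exists j => //.
      by near: j.
    rewrite log_ratio_le//= lee_fin => NleV.
    suff -> : N = 0%N by [].
    apply/eqP; rewrite -leqn0 -ltnS -(ltr_nat R) (le_lt_trans NleV)//.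
    by rewrite mulN1r powRN powR_mulrn// invf_lt1 ?exprn_gt0// exprn_egt1 ?ltr1n// -lt0n.
apply/lee_addgt0Pr => d d0; have [e e0 ev] := H d d0.
apply: ge_ereal_inf; exists (growth_rate x a e).
  by exists e => //=; rewrite in_itv/= e0.
apply: ge_ereal_inf; eexists.
  exists ([set j | (0 < j)%N] `&` [set j | ((large_count x j
    (2 `^ (- (a + e) * j%:R)))%:R%:E <= powe2 (b + d%:E) j)%E]) => //.
  by apply: filterI => //; exists 1%N.
by apply: ge_ereal_sup => _ [j [/= j0 jle] <-]; rewrite log_ratio_le.
Unshelve. all: by end_near. Qed.

Lemma near_le_mul e (r : R) : 0 < e -> \forall j \near \oo, r <= e * j%:R.
Proof.
move=> e0; near=> j; rewrite -ler_pdivrMl// mulrC; near: j.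
exact: nbhs_infty_ger.
Unshelve. all: by end_near. Qed.

Lemma powe2_double b e j : 1 <= e * j%:R ->
  (powe2 b j + powe2 b j <= powe2 (b + e%:E) j)%E.
Proof.
move=> ej; rewrite powe2D; set p := powe2 _ j.
rewrite (_ : p + p = p * 2%:E)%E; last first.
  by rewrite -[2%R]/(1 + 1)%R EFinD ge0_muleDr// ?mule1// lee_fin.
apply: lee_pmul => //; rewrite ?powe2_ge0// lee_fin.
by rewrite -[leLHS]powRr1//; apply: ler_powR; rewrite ?ler1n.
Qed.

Definition Snu (nu : R -> \bar R) : set Omega :=
  [set x | forall a, (asymptotic_profile x a <= nu a)%E].

Lemma SnuP nu x : Snu nu x <-> forall a d : R, 0 < d -> exists2 e : R, 0 < e &
  \forall j \near \oo, ((large_count x j (2 `^ (- (a + e) * j%:R)))%:R%:E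
       <= powe2 (nu a + d%:E) j)%E.
Proof. by split=> [H a|H a]; apply/asymptotic_profile_leP; exact: H. Qed.

Lemma Snu_submod_closed nu : GRing.submod_closed (fun x => x \in Snu nu).
Proof.
split.
  apply/mem_set/SnuP => a d d0; exists 1 => //; near=> j.
  by rewrite large_count0 ?powR_gt0// powe2_ge0.
move=> l x y /set_mem/SnuP Sx /set_mem/SnuP Sy; apply/mem_set/SnuP => a d d0.
have d20 : 0 < d / 2 by rewrite divr_gt0.
have [ex ex0 Hx] := Sx a _ d20.
have [ey ey0 Hy] := Sy a _ d20.
pose e := Num.min ex ey / 2.
have e0 : 0 < e by rewrite divr_gt0// lt_min ex0 ey0.
have ee : e + e = Num.min ex ey by rewrite -splitr.
pose M : R := Num.max 1 (normc l).
have M0 : 0 < M by rewrite lt_max ltr01.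
exists e => //; near=> j.
set t := 2 `^ _.
have t0 : 0 < t by rewrite powR_gt0.
have tM : 2 `^ (- (a + (e + e)) * j%:R) <= t / 2 / M.
  rewrite -mulrA -invfM ler_pdivlMr ?mulr_gt0// /t.
  rewrite addrA -(addrA a) addrA opprD mulrDl powRD ?pnatr_eq0 ?implybT//.
  rewrite -mulrA ger_pMr ?powR_gt0// mulNr powRN mulrC.
  rewrite ler_pdivrMr ?powR_gt0// mul1r.
  rewrite -(@powRr1 R (2 * M)) ?mulr_ge0 ?(ltW M0)//.
  have -> : 2 * M = 2 `^ (ln (2 * M) / ln 2).
    rewrite /powR pnatr_eq0/= divfK ?lnK ?posrE ?mulr_gt0//.
    by rewrite gt_eqF// ln_gt0// ltr1n.
  rewrite -powRrM mulr1; apply: ler_powR; rewrite ?ler1n//.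
  by near: j; exact: near_le_mul.
have powe2_half : ((powe2 (nu a + (d / 2)%:E) j)
    + (powe2 (nu a + (d / 2)%:E) j) <= powe2 (nu a + d%:E) j)%E.
  rewrite [in leRHS](splitr d) EFinD addeA; apply: powe2_double.
  by near: j; exact: near_le_mul.
apply: (le_trans _ powe2_half).
have Hx' : ((large_count (l *: x)%R j (t / 2)%R)%:R%:E
    <= powe2 (nu a + (d / 2)%:E) j)%E.
  apply: (@le_trans _ _
    (large_count x j (2 `^ (- (a + ex) * j%:R)))%:R%:E); last by near: j.
  rewrite lee_fin ler_nat.
  apply: (leq_trans (@large_countZ l x j _ M M0 _)).
    by rewrite le_max lexx orbT.
  apply: large_count_le; apply: (le_trans _ tM).
  apply: ler_powR; rewrite ?ler1n// ler_wpM2r// lerN2 lerD2l ee.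
  by rewrite ge_min lexx.
have Hy' : ((large_count y j (t / 2)%R)%:R%:E
    <= powe2 (nu a + (d / 2)%:E) j)%E.
  apply: (@le_trans _ _
    (large_count y j (2 `^ (- (a + ey) * j%:R)))%:R%:E); last by near: j.
  rewrite lee_fin ler_nat.
  apply: large_count_le.
  apply: (@le_trans _ _ (t / 2 / M)); last first.
    rewrite ler_pdivrMr// ler_peMr// ?divr_ge0 ?(ltW t0)//.
    by rewrite le_max lexx.
  apply: (le_trans _ tM).
  apply: ler_powR; rewrite ?ler1n// ler_wpM2r// lerN2 lerD2l ee.
  by rewrite ge_min lexx orbT.
apply: (le_trans _ (leeD Hx' Hy')).
by rewrite -EFinD lee_fin -natrD ler_nat [t in leqLHS]splitr large_countD.
Unshelve. all: by end_near. Qed.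

(* gauge a b is d_{a,b}; its value is +oo when no bound C exists. *)
Definition gauge_bound a b x : set R :=
  [set C | 0 <= C /\ forall j,
    ((large_count x j (C * 2 `^ (- a * j%:R)))%:R%:E <= C%:E * powe2 b j)%E].

Definition gauge a b x : \bar R := ereal_inf [set C%:E | C in gauge_bound a b x].

Lemma gauge_bound_le a b x C C' :
  C <= C' -> gauge_bound a b x C -> gauge_bound a b x C'.
Proof.
move=> CC' [C0 xC]; split; first exact: le_trans CC'.
move=> j; apply: (@le_trans _ _ (C%:E * powe2 b j)%E); last first.
  by apply: lee_wpmul2r; rewrite ?powe2_ge0// lee_fin.
apply: (le_trans _ (xC j)); rewrite lee_fin ler_nat; apply: large_count_le.
by rewrite ler_wpM2r// powR_ge0.
Qed.

Lemma gauge_lt_bound a b x C : (gauge a b x < C%:E)%E -> gauge_bound a b x C.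
Proof.
move=> /ereal_inf_lt[_ [C' xC' <-]]; rewrite lte_fin => /ltW C'C.
exact: gauge_bound_le xC'.
Qed.

Lemma gauge_bound_gauge a b x C : gauge_bound a b x C -> (gauge a b x <= C%:E)%E.
Proof. by move=> xC; apply: ereal_inf_lbound; exists C. Qed.

Lemma gauge0_lt a b C : 0 < C -> (gauge a b 0%R < C%:E)%E.
Proof.
move=> C0; apply: (@le_lt_trans _ _ (C / 2)%:E); last first.
  by rewrite lte_fin gtr_pMr// invf_lt1// ltr1n.
have C20 : 0 < C / 2 by rewrite divr_gt0.
apply: gauge_bound_gauge; split; first exact: ltW.
move=> j; rewrite large_count0 ?mulr_gt0 ?powR_gt0//.
by rewrite mule_ge0 ?powe2_ge0// lee_fin ltW.
Qed.

Lemma gaugeN a b x : gauge a b (- x) = gauge a b x.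
Proof.
congr (ereal_inf [set _%:E | _ in _]); apply/seteqP.
by split=> C [C0 xC]; split=> // j; move: (xC j); rewrite large_countN.
Qed.

Lemma gauge_boundD a b x y C C' : gauge_bound a b x C ->
  gauge_bound a b y C' -> gauge_bound a b (x + y) (C + C').
Proof.
move=> [C0 xC] [C'0 yC']; split; first exact: addr_ge0.
move=> j; rewrite EFinD ge0_muleDl ?lee_fin//.
apply: (le_trans _ (leeD (xC j) (yC' j))).
by rewrite -EFinD -natrD lee_fin ler_nat mulrDl; exact: large_countD.
Qed.

Lemma gaugeD_lt a b x y C C' : (gauge a b x < C%:E)%E ->
  (gauge a b y < C'%:E)%E -> (gauge a b (x + y)%R < (C + C')%:E)%E.
Proof.
move=> /ereal_inf_lt[_ [D xD <-]] DC /ereal_inf_lt[_ [D' yD' <-]] D'C'.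
apply: (le_lt_trans (gauge_bound_gauge (gauge_boundD xD yD'))).
rewrite !lte_fin in DC D'C' *; exact: ltrD.
Qed.

Lemma gauge_boundZ a b (l : R[i]) x C M : 1 <= M -> normc l <= M ->
  gauge_bound a b x C -> gauge_bound a b (l *: x) (M * C).
Proof.
move=> M1 lM [C0 xC]; have M0 : 0 < M by rewrite (lt_le_trans _ M1).
split; first by rewrite mulr_ge0// ltW.
move=> j; apply: (@le_trans _ _ (C%:E * powe2 b j)%E); last first.
  by apply: lee_wpmul2r; rewrite ?powe2_ge0// lee_fin ler_peMl.
apply: (le_trans _ (xC j)); rewrite lee_fin ler_nat.
apply: (leq_trans (@large_countZ l x j _ M M0 lM)).
by rewrite -(mulrA M) [_ / M]mulrC mulKf// gt_eqF.
Qed.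

Lemma large_count_init x a J : exists2 M : R, 1 <= M &
  forall j, (j < J)%N -> large_count x j (M * 2 `^ (- a * j%:R)) = 0%N.
Proof.
pose F (j : nat) (k : 'I_(2 ^ j)) := normc (x (existT _ j k)) * 2 `^ (a * j%:R).
have F0 j k : 0 <= F j k by rewrite mulr_ge0 ?normc_ge0 ?powR_ge0.
exists (1 + \sum_(j < J) \sum_k F j k).
  by rewrite lerDl; do 2 (apply: sumr_ge0 => ? _); exact: F0.
move=> j jJ; apply: large_count_eq0 => k.
rewrite mulNr powRN ltr_pdivlMr ?powR_gt0// -/(F j k).
rewrite ltr_pwDl// (bigD1 (Ordinal jJ))//= (bigD1 k)//= -addrA lerDl.
by rewrite addr_ge0//; apply: sumr_ge0 => ? _//; apply: sumr_ge0 => ? _.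
Qed.

Lemma Snu_gauge_bound nu x a e C : Snu nu x -> 0 < e -> 0 < C ->
  exists2 M : R, 0 < M & forall j,
    ((large_count x j (M * 2 `^ (- a * j%:R)))%:R%:E
       <= C%:E * powe2 (nu a + e%:E) j)%E.
Proof.
move=> /SnuP Sx e0 C0; have e20 : 0 < e / 2 by rewrite divr_gt0.
have [e' e'0 [J _ HJ]] := Sx a _ e20.
have [J' _ HJ'] := near_le_mul (- ln C / ln 2) e20.
have [M M1 HM] := large_count_init x a (maxn J J').
exists M; first by rewrite (lt_le_trans _ M1).
move=> j; have [jJ|] := ltnP j (maxn J J').
  by rewrite HM// mule_ge0 ?powe2_ge0// lee_fin ltW.
rewrite geq_max => /andP[Jj J'j].
apply: (@le_trans _ _ (powe2 (nu a + (e / 2)%:E) j)).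
  apply: (le_trans _ (HJ _ Jj)); rewrite lee_fin ler_nat.
  apply: large_count_le; apply: (@le_trans _ _ (1 * 2 `^ (- a * j%:R))).
    rewrite mul1r; apply: ler_powR; rewrite ?ler1n// ler_wpM2r// lerN2.
    by rewrite lerDl ltW.
  by rewrite ler_wpM2r// powR_ge0.
rewrite [in leRHS](splitr e) EFinD addeA [in leRHS]powe2D muleCA -[leLHS]mule1.
apply: lee_wpmul2l; rewrite ?powe2_ge0// -EFinM lee_fin.
have := HJ' _ J'j; rewrite /= ler_pdivrMr ?ln_gt0 ?ltr1n// => H.
rewrite -[C in leRHS]lnK ?posrE// -[2 `^ _]lnK ?posrE ?powR_gt0//.
by rewrite ln_powR -expRD -[leLHS]expR0 ler_expR -lerBlDl sub0r.
Qed.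

Lemma Snu_gauge_lty nu x a e :
  Snu nu x -> 0 < e -> (gauge a (nu a + e%:E) x < +oo)%E.
Proof.
move=> Sx e0; have [M M0 HM] := Snu_gauge_bound a Sx e0 ltr01.
apply: (@le_lt_trans _ _ (Num.max M 1)%:E); last exact: ltry.
apply: gauge_bound_gauge; split; first by rewrite le_max ler01 orbT.
move=> j; apply: (@le_trans _ _ (1%:E * powe2 (nu a + e%:E) j)%E); last first.
  by apply: lee_wpmul2r; rewrite ?powe2_ge0// lee_fin le_max lexx orbT.
apply: (le_trans _ (HM j)); rewrite lee_fin ler_nat; apply: large_count_le.
by rewrite ler_wpM2r ?powR_ge0// le_max lexx.
Qed.

Lemma Snu_gaugeZ nu x a e C : Snu nu x -> 0 < e -> 0 < C ->
  exists2 d : R, 0 < d & forall l : R[i], normc l < d ->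
    (gauge a (nu a + e%:E) (l *: x)%R < C%:E)%E.
Proof.
move=> Sx e0 C0; have C20 : 0 < C / 2 by rewrite divr_gt0.
have [M M0 HM] := Snu_gauge_bound a Sx e0 C20.
exists (C / 2 / M); first by rewrite divr_gt0.
move=> l ld; apply: (@le_lt_trans _ _ (C / 2)%:E); last first.
  by rewrite lte_fin gtr_pMr// invf_lt1// ltr1n.
apply: gauge_bound_gauge; split; first exact: ltW.
move=> j; apply: (le_trans _ (HM j)); rewrite lee_fin ler_nat.
apply: (leq_trans (@large_countZ l x j _ _ _ (ltW ld))).
  by rewrite divr_gt0.
apply: large_count_le.
by rewrite ler_pdivlMr ?divr_gt0// mulrC mulrA divfK// gt_eqF.
Qed.

Lemma gauge_eq0 a b x : (b < +oo)%E -> gauge a b x = 0%E -> x = 0.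
Proof.
move=> blty x0; apply/funext => -[j k]; apply: eq0_normc; apply/eqP.
rewrite eq_le normc_ge0 andbT leNgt; apply/negP => m0.
set m := normc _ in m0.
have [p p0 pE] : exists2 p : R, 0 <= p & powe2 b j = p%:E.
  case: b blty {x0} => [r| |]//= _; last by exists 0.
  by exists (2 `^ (r * j%:R)) => //; rewrite powR_ge0.
pose C := Num.min (m * 2 `^ (a * j%:R)) (p + 1)^-1.
have p10 : 0 < p + 1 by rewrite ltr_wpDl.
have C0 : 0 < C by rewrite lt_min mulr_gt0 ?powR_gt0//= invr_gt0.
have /gauge_lt_bound[_ /(_ j)] : (gauge a b x < C%:E)%E by rewrite x0 lte_fin.
rewrite pE -EFinM lee_fin leNgt => /negP; apply.
apply: (@lt_le_trans _ _ 1).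
  apply: (@le_lt_trans _ _ ((p + 1)^-1 * p)).
    by rewrite ler_wpM2r// ge_min lexx orbT.
  by rewrite mulrC ltr_pdivrMr// mul1r ltrDl.
rewrite (ler_nat R 1) /large_count; apply/card_gt0P; exists k; rewrite inE /= -/m.
by rewrite mulNr powRN ler_pdivrMr ?powR_gt0// ge_min lexx.
Qed.

(* E(a, b), with the balls of d_{a,b}; by gauge_eq0 this pseudometric is a
   metric for b < +oo, the only case of interest. *)
Definition gauge_space a b : Type :=
  {x : Omega | x \in [set x | (gauge a b x < +oo)%E]}.

HB.instance Definition _ a b := SubChoice.on (gauge_space a b).

Definition gauge_ball a b (x : gauge_space a b) (r : R) : set (gauge_space a b) :=
  [set y | (gauge a b (val x - val y)%R < r%:E)%E].

HB.instance Definition _ a b := hasNbhs.Build (gauge_space a b)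
  (nbhs_ (entourage_ (@gauge_ball a b))).

Lemma gauge_ball_center a b (x : gauge_space a b) r : 0 < r -> gauge_ball x r x.
Proof. by move=> r0; rewrite /gauge_ball/= subrr gauge0_lt. Qed.

Lemma gauge_ball_sym a b (x y : gauge_space a b) r :
  gauge_ball x r y -> gauge_ball y r x.
Proof. by rewrite /gauge_ball/= -gaugeN opprB. Qed.

Lemma gauge_ball_triangle a b (x y z : gauge_space a b) r1 r2 :
  gauge_ball x r1 y -> gauge_ball y r2 z -> gauge_ball x (r1 + r2) z.
Proof.
by rewrite /gauge_ball/= => /gaugeD_lt /[apply]; rewrite addrA subrK.
Qed.

HB.instance Definition _ a b := @Nbhs_isPseudoMetric.Build R (gauge_space a b)
  (entourage_ (@gauge_ball a b)) erefl (@gauge_ball a b)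
  (@gauge_ball_center a b) (@gauge_ball_sym a b) (@gauge_ball_triangle a b) erefl.

(* alpha and eps only serve to determine the topology. *)
Definition Snu_space (nu : R -> \bar R) (alpha : nat -> R)
  (eps : nat -> {posnum R}) : Type := {x : Omega | x \in Snu nu}.

Section Snu_space.
Variables (nu : R -> \bar R) (alpha : nat -> R) (eps : nat -> {posnum R}).
Local Notation Snu_space := (Snu_space nu alpha eps).

HB.instance Definition _ := SubChoice.on Snu_space.
HB.instance Definition _ := GRing.SubChoice_isSubLmodule.Build
  R[i] Omega (fun x => x \in Snu nu) Snu_space
  (GRing.submod_closed_semi (Snu_submod_closed nu)).

Definition Snu_inclusion (nm : nat * nat) (x : Snu_space) :
    gauge_space (alpha nm.1) (nu (alpha nm.1) + (eps nm.2)%:num%:E)%E :=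
  exist _ (val x)
    (mem_set (Snu_gauge_lty (alpha nm.1) (set_mem (valP x)) (gt0 (eps nm.2)))).

(* The coarsest topology making every inclusion
   S^nu -> E(alpha_n, nu(alpha_n) + eps_m) continuous. *)
HB.instance Definition _ := Topological.copy Snu_space
  (sup_topology (fun nm => Topological.class
     (initial_topology (Snu_inclusion nm)))).

Local Notation gap nm x y :=
  (gauge (alpha nm.1) (nu (alpha nm.1) + (eps nm.2)%:num%:E)%E
     (val x - val y)%R).

Lemma near_Snu (x : Snu_space) nm (r : R) : 0 < r ->
  \forall y \near x, (gap nm x y < r%:E)%E.
Proof.
move=> r0.
have /cvg_sup/(_ nm) cvx : nbhs x --> x by [].
have : Snu_inclusion nm @ nbhs x --> Snu_inclusion nm x.
  apply: (cvg_trans _ (@initial_continuous _ _ (Snu_inclusion nm) x)).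
  exact: cvg_app.
by move=> /(_ _ (nbhsx_ballx _ _ r0)).
Qed.

Lemma cvg_Snu (T : Type) (F : set_system T) {FF : Filter F}
    (f : T -> Snu_space) (l : Snu_space) :
  (forall nm (r : R), 0 < r -> \forall t \near F, (gap nm l (f t) < r%:E)%E) ->
  f @ F --> l.
Proof.
move=> H; apply/cvg_sup => nm A [_ [[C oC <-] Cl] CA].
have /nbhs_ballP[r /= r0 rC] := open_nbhs_nbhs (conj oC Cl).
by apply: filterS (H nm r r0) => t lt; apply: CA; exact: rC.
Qed.

Lemma Snu_add_continuous : continuous (fun z : Snu_space * Snu_space => z.1 + z.2).
Proof.
move=> [x y]; apply: cvg_Snu => nm r r0.
have r20 : 0 < r / 2 by rewrite divr_gt0.
exists ([set x' | (gap nm x x' < (r / 2)%:E)%E],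
        [set y' | (gap nm y y' < (r / 2)%:E)%E]).
  by split; exact: near_Snu.
move=> [x' y'] /= [xx' yy'].
by rewrite opprD addrACA [r]splitr; exact: gaugeD_lt.
Qed.

HB.instance Definition _ :=
  PreTopologicalNmodule_isTopologicalNmodule.Build Snu_space Snu_add_continuous.

Lemma Snu_scale_continuous :
  continuous (fun z : R[i]^o * Snu_space => z.1 *: z.2).
Proof.
move=> [l x]; apply: cvg_Snu => nm r r0.
have r20 : 0 < r / 2 by rewrite divr_gt0.
have [d d0 Hd] := Snu_gaugeZ (alpha nm.1) (set_mem (valP x)) (gt0 (eps nm.2)) r20.
pose M := normc l + d + 1.
have M1 : 1 <= M by rewrite lerDr addr_ge0 ?normc_ge0// ltW.
have M0 : 0 < M by rewrite (lt_le_trans _ M1).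
have rM0 : 0 < r / 2 / M / 2 by rewrite !divr_gt0.
exists ([set l' : R[i]^o | normc (l - l') < d],
        [set x' | (gap nm x x' < (r / 2 / M / 2)%:E)%E]).
  split; last exact: near_Snu.
  apply/nbhs_ballP; exists d%:C%C => /=; first by rewrite ltcR.
  by move=> l'; rewrite /ball/= -ltcR.
move=> [l' x'] /= [ll' xx'].
rewrite (_ : _ - _ = (l - l') *: val x + l' *: (val x - val x')); last first.
  by rewrite scalerBl scalerBr addrA subrK.
rewrite [r]splitr; apply: gaugeD_lt; first exact: Hd.
apply: (@le_lt_trans _ _ (M * (r / 2 / M / 2))%:E).
  apply: gauge_bound_gauge; apply: gauge_boundZ => //; last exact: gauge_lt_bound.
  rewrite -[l'](subKr l) (le_trans (le_normcD _ _))// normcN /M -addrA lerD2l.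
  by rewrite (le_trans (ltW ll'))// lerDl.
rewrite lte_fin -!mulrA [M^-1 * _]mulrC !mulrA mulrC !mulrA mulVf ?gt_eqF// mul1r.
by rewrite gtr_pMr// invf_lt1// ltr1n.
Qed.

HB.instance Definition _ := TopologicalNmodule_isTopologicalLmodule.Build
  R[i] Snu_space Snu_scale_continuous.

End Snu_space.

Record admissible_profile (nu : R -> \bar R) : Prop := AdmissibleProfile {
  profile_nondecreasing : nondecreasing_fun nu ;
  profile_right_continuous : right_continuous nu ;
  profile_range : forall a, nu a = -oo%E \/ (0 <= nu a <= 1)%E ;
  profile_nontrivial : exists a, nu a <> -oo%E }.

Definition right_inf_derivative (nu : R -> \bar R) a : \bar R :=
  limf_einf (fun h : R => (nu (a + h)%R - nu a) / h%:E)%E 0^'+.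

Definition p0 (nu : R -> \bar R) : \bar R :=
  Order.min 1%E
    (ereal_inf [set right_inf_derivative nu a | a in [set a | (0 <= nu a < 1)%E]]).

End sequence_space.

(* Main.v *)
(* Write <c, x> for the sum of c_i x_i. If p_0 = 1, the profile grows at slope
   at least 1 wherever 0 <= nu < 1, so the large coefficients of x contribute to
   the sum of the 2^((nu(a) + e) j) largest moduli at level j no more than the
   coefficients of size about 2^(-a j) do. Hence every gauge ball contains a
   neighbourhood { x : |<c, x>| <= 1 for all c in F } with F a set of finitely
   supported sequences, and S^nu is locally convex. Truncation converges
   uniformly on bounded sets, so the finitely supported forms are dense in the
   strong dual, and an element phi of the bidual is the evaluation at the
   sequence x of its values on the coordinate forms. The sets F bound
   <c, x> = phi(c), which puts x in S^nu, and, being equicontinuous, they make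
   the evaluation open. Metrizability makes bounded sets of the dual
   equicontinuous, so the evaluation is continuous.
   If p_0 < 1, there are a with 0 <= nu(a) < 1 and a' > a arbitrarily close with
   nu(a') < nu(a) + a' - a. At level j, the mean of 2^((a' - a) j) disjoint
   blocks of 2^(nu(a) j) coefficients 2^(-a j) has 2^((nu(a) + a' - a) j)
   coefficients of size 2^(-a' j): the blocks enter every neighbourhood of 0 as
   j grows, but their means stay away from 0. *)
Require Import Defs.
From mathcomp Require Import all_boot all_order all_algebra.
From mathcomp Require Import all_classical all_reals all_analysis.
From mathcomp Require Import complex ring lra.
Set Implicit Arguments.
Unset Strict Implicit.
Unset Printing Implicit Defensive.
Import Order.TTheory GRing.Theory Num.Theory.
Import numFieldNormedType.Exports.
Import ComplexField.Normc.
Local Open Scope classical_set_scope.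
Local Open Scope ring_scope.

(** * Neighbourhoods in the strong dual *)

Section strong_dual_topology.
Context {K : numFieldType}.
Variable E : preTopologicalLmodType K.
Implicit Types (f g : strong_dual E) (A B : set E).

Lemma vN_bounded0 : vN_bounded (set0 : set E).
Proof. by move=> U _; exists 1 => // t _ x. Qed.

Lemma vN_boundedU A B : vN_bounded A -> vN_bounded B -> vN_bounded (A `|` B).
Proof.
move=> bA bB U U0; have [r r0 rA] := bA U U0; have [s s0 sB] := bB U U0.
exists (r + s); first by rewrite addr_gt0.
move=> t rst x [Ax|Bx].
  by apply: rA Ax; rewrite (le_trans _ rst)// lerDl ltW.
by apply: sB Bx; rewrite (le_trans _ rst)// lerDr ltW.
Qed.

Lemma strong_dual_linear f : linear (val f).
Proof. by have /set_mem[] := valP f. Qed.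

Lemma strong_dual_continuous f : continuous (val f).
Proof. by have /set_mem[] := valP f. Qed.

Lemma strong_dual0 f : val f 0 = 0.
Proof.
by rewrite -[0 in LHS](addNr 0) -scaleN1r strong_dual_linear scaleN1r addNr.
Qed.

Lemma strong_dualZ f (a : K) (x : E) : val f (a *: x) = a * val f x.
Proof. by rewrite -[a *: x]addr0 strong_dual_linear strong_dual0 addr0. Qed.

Lemma strong_dualB f (x y : E) : val f (x - y) = val f x - val f y.
Proof. by rewrite addrC -scaleN1r strong_dual_linear scaleN1r addrC. Qed.

Lemma near_strong_dual f B (e : K) : vN_bounded B -> 0 < e ->
  \forall g \near f, forall x, B x -> `|val f x - val g x| < e.
Proof.
move=> bB e0.
have cvf : (val : strong_dual E -> {family @vN_bounded K E, E -> K^o}) @ f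
    --> (val f : {family @vN_bounded K E, E -> K^o}).
  exact: initial_continuous.
have /(_ B bB) H := (fam_cvgP _ _ (fmap_filter val (nbhs_filter f))).1 cvf.
apply: (H [set h | forall x, B x -> `|val f x - h x| < e]).
apply/uniform_nbhs; exists [set xy : K^o * K^o | `|xy.1 - xy.2| < e].
split; last by [].
by rewrite -entourage_ballE; exists e.
Qed.

(** Bounded sets are stable under finite unions, so the sets [V (B, e)] generate a filter. It
    converges to [f] uniformly on every bounded set, hence contains every neighbourhood of [f]. *)
Lemma nbhs_strong_dual f (U : set (strong_dual E)) : nbhs f U ->
  exists2 B, vN_bounded B & exists2 e : K, 0 < e &
    forall g, (forall x, B x -> `|val f x - val g x| < e) -> U g.
Proof.
pose P (Be : set E * K) := vN_bounded Be.1 /\ 0 < Be.2.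
pose V (Be : set E * K) :=
  [set h : E -> K^o | forall x, Be.1 x -> `|val f x - h x| < Be.2].
pose G := filter_from P V.
have FG : Filter G.
  apply: filter_from_filter; first by exists (set0, 1); split => //;
    exact: vN_bounded0.
  move=> [A d] [B e] [/= bA d0] [/= bB e0].
  (* The order of [K] is only partial, but positive elements are real, hence comparable. *)
  have cde : d >=< e by apply: real_comparable; exact: gtr0_real.
  exists (A `|` B, Order.min d e).
    by split; [exact: vN_boundedU|rewrite /= comparable_lt_min// d0].
  move=> h hV; split=> x /= Ax.
    have := hV x (or_introl Ax); rewrite /= => /lt_le_trans; apply.
    by rewrite comparable_ge_min// lexx.
  have := hV x (or_intror Ax); rewrite /= => /lt_le_trans; apply.
  by rewrite comparable_ge_min// lexx orbT.
have Gf : G --> (val f : {family @vN_bounded K E, E -> K^o}).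
  apply/fam_cvgP => A bA Q /uniform_nbhs[W [entW WQ]].
  move: entW; rewrite -entourage_ballE => -[e /= e0 eW].
  exists (A, e) => // h hV; apply: WQ => y Ay; apply: eW; exact: hV.
move=> [_ [[W oW <-] Wf] WU].
have [[B e] [bB e0] BW] : G W by apply: Gf; exact: open_nbhs_nbhs.
exists B => //; exists e => // g gB; apply: WU; exact: BW.
Qed.

End strong_dual_topology.

(** * Translations and dilations of neighbourhoods *)

Section topological_module.
Context {K : numFieldType}.
Variable E : topologicalLmodType K.

Lemma near0_shift (x : E) (U : set E)
  : nbhs 0 U -> \forall y \near x, U (y - x).
Proof.
move=> U0; apply: filterS (nbhsT_subproof (@add_continuous E) x U0) =>
  y [u Uu <-].
by rewrite addrAC subrr add0r.
Qed.

Lemma near_shift0 (x : E) (U : set E)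
  : nbhs x U -> \forall y \near 0, U (x + y).
Proof.
move=> Ux; have := nbhsB_subproof (@add_continuous E) (- x) Ux.
by rewrite addNr; apply: filterS => _ [u Uu <-]; rewrite addrA subrr add0r.
Qed.

Lemma nbhs0_scale (U : set E) (t : K) :
  nbhs 0 U -> \forall x \near (0 : E), U (t *: x).
Proof.
move=> U0; have /= := @scale_continuous K E (t, 0) U;
  rewrite scaler0 => /(_ U0).
move=> [[A B] /= [At B0] AB]; apply: filterS B0 => x Bx.
by apply: (AB (t, x)); split=> //=; exact: (nbhs_singleton At).
Qed.

Lemma continuous_formP (f : E -> K^o) : linear f ->
  (forall e : K, 0 < e -> \forall x \near 0, `|f x| < e) ->
  f \in @continuous_form K E.
Proof.
move=> lf f0; apply/mem_set; split=> // x.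
apply/cvgrPdist_lt => e e0; apply: filterS (near0_shift x (f0 e e0)) => y.
rewrite distrC; congr (`|_| < _).
by rewrite addrC -scaleN1r lf scaleN1r addrC.
Qed.

End topological_module.

(** * Monotonicity of the gauges *)

Section gauge_theory.
Context {R : realType}.
Implicit Types (x y : @Omega R) (j : nat) (t a e C : R) (b : \bar R).

Lemma powe2_le b b' j : (b <= b')%E -> (powe2 b j <= powe2 b' j)%E.
Proof.
case: b b' => [r| |] [r'| |] //=; rewrite ?leey ?lee_fin ?powR_ge0 //.
by move=> rr'; apply: ler_powR; rewrite ?ler1n// ler_wpM2r.
Qed.

(** Passing from [a'] to [a] raises the threshold, which lowers the count; passing from [b'] to [b]
    raises the allowed count. *)
Lemma gauge_bound_weaken a a' b b' x C : a <= a' -> (b' <= b)%E ->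
  gauge_bound a' b' x C -> gauge_bound a b x C.
Proof.
move=> aa' bb' [C0 xC]; split=> // j.
apply: (@le_trans _ _ (C%:E * powe2 b' j)%E); last first.
  by apply: lee_wpmul2l; [rewrite lee_fin|exact: powe2_le].
apply: (le_trans _ (xC j)); rewrite lee_fin ler_nat; apply: large_count_le.
by rewrite ler_wpM2l// ler_powR ?ler1n// ler_wpM2r// lerN2.
Qed.

Lemma gauge_weaken a a' b b' x (c : \bar R) : a <= a' -> (b' <= b)%E ->
  (gauge a' b' x < c)%E -> (gauge a b x < c)%E.
Proof.
move=> aa' bb'; apply: le_lt_trans.
apply: le_ereal_inf => _ [D xD <-]; exists D => //.
exact: gauge_bound_weaken xD.
Qed.

Lemma gauge_contract a b x (l : R[i]) (c : \bar R) : normc l <= 1 ->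
  (gauge a b x < c)%E -> (gauge a b (l *: x)%R < c)%E.
Proof.
move=> l1; apply: le_lt_trans; apply: le_ereal_inf => _ [D xD <-];
  exists D => //.
by rewrite -[D]mul1r; apply: gauge_boundZ.
Qed.

Lemma near_le_pow2 e C : 0 < e -> \forall j \near \oo, C <= 2 `^ (e * j%:R).
Proof.
move=> e0; have C0 : 0 < Num.max C 1 by rewrite lt_max ltr01 orbT.
near=> j.
apply: (@le_trans _ _ (Num.max C 1)); first by rewrite le_max lexx.
have -> : Num.max C 1 = 2 `^ (ln (Num.max C 1) / ln 2).
  rewrite /powR pnatr_eq0/= divfK ?lnK ?posrE//.
  by rewrite gt_eqF// ln_gt0// ltr1n.
apply: ler_powR; rewrite ?ler1n//.
by near: j; exact: near_le_mul.
Unshelve. all: by end_near. Qed.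

(** A count is an integer, so a bound below 1 makes it vanish. *)
Lemma gauge_bound_coord a b x C j (k : 'I_(2 ^ j)) : gauge_bound a b x C ->
  (C%:E * powe2 b j < 1)%E -> normc (x (existT _ j k)) < C * 2 `^ (- a * j%:R).
Proof.
move=> [C0 /(_ j) xC] C1; rewrite ltNge; apply/negP => xk.
have := le_lt_trans xC C1; rewrite lte_fin (ltr_nat R _ 1) ltnS leqn0.
by move=> /eqP/card0_eq/(_ k); rewrite inE xk.
Qed.

End gauge_theory.

(** * The topology of S^nu and its gauges *)

Section Snu_topology.
Context {R : realType} {nu : R -> \bar R} {alpha : nat -> R}
  {eps : nat -> {posnum R}}.
Context (nu_admissible : admissible_profile nu)
  (alpha_dense : dense (range alpha))
  (eps_cvg0 : (eps m)%:num @[m --> \oo] --> (0 : R)).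
Local Notation S := (Snu_space nu alpha eps).
Implicit Types (a e r : R).

Lemma profile_lty a : (nu a < +oo)%E.
Proof.
have [->//|/andP[_ nu1]] := profile_range nu_admissible a.
by rewrite (le_lt_trans nu1)// ltry.
Qed.

(** Right continuity supplies one point [y > a]; monotonicity covers everything to its left. *)
Lemma profile_lt a (b : \bar R) : (nu a < b)%E ->
  exists2 h, 0 < h & forall h', h' <= h -> (nu (a + h') < b)%E.
Proof.
move=> nub; have /= Hr := profile_right_continuous nu_admissible (x := a).
have : \forall y \near nu a, (y < b)%E.
  by apply: open_nbhs_nbhs; split => //; exact: open_ereal_lt_ereal.
move=> /Hr/= => H.
have : \forall y \near a^'+, a < y /\ (nu y < b)%E.
  by near=> y; split; near: y => //; exact: nbhs_right_gt.
move=> /(@filter_ex _ _ _)[y [ay nuy]].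
exists (y - a); first by rewrite subr_gt0.
move=> h' h'y; apply: le_lt_trans nuy.
by apply: profile_nondecreasing => //; rewrite -lerBrDl.
Unshelve. all: by end_near. Qed.

Lemma profile_le a e : 0 < e ->
  exists2 h, 0 < h & forall h', h' <= h -> (nu (a + h') <= nu a + e%:E)%E.
Proof.
move=> e0; case E : (nu a) => [r| |].
- have [|h h0 H] := @profile_lt a (r + e)%:E; first by rewrite E lte_fin ltrDl.
  by exists h => // h' /H/ltW; rewrite EFinD.
- by have := profile_lty a; rewrite E.
(* Since [nu] takes no finite negative value, [nu < 0] means [nu = -oo]. *)
- have [|h h0 H] := @profile_lt a 0%E; first by rewrite E.
  exists h => // h' /H; have [->//|/andP[nu0 _]]
    := profile_range nu_admissible (a + h').
  by move=> /(le_lt_trans nu0); rewrite ltxx.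
Qed.

(** Density and right continuity provide [alpha n] just right of [a] and [eps m < e / 2] whose gauge
    dominates this one: the topology does not depend on the sequences. *)
Lemma near_gauge a e r : 0 < e -> 0 < r ->
  \forall x \near (0 : S), (gauge a (nu a + e%:E) (val x) < r%:E)%E.
Proof.
move=> e0 r0; have e20 : 0 < e / 2 by rewrite divr_gt0.
have [h h0 nuh] := profile_le a e20.
have [n /andP[an nh]] : exists n, a < alpha n < a + h.
  have [||y [/= yO [n _ nE]]] := @alpha_dense `]a, (a + h)[%classic.
  - exists (a + h / 2); rewrite /= in_itv/= ltrDl divr_gt0//= ltrD2l.
    by rewrite gtr_pMr// invf_lt1// ltr1n.
  - exact: interval_open.
  - by exists n; rewrite nE; move: yO; rewrite in_itv.
have [m em] : exists m, (eps m)%:num < e / 2.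
  have /cvgr_lt/(_ _ e20) := eps_cvg0.
  by move=> /(@filter_ex _ _ _).
have := @near_Snu R nu alpha eps 0 (n, m) r r0; apply: filterS => x /=.
rewrite sub0r gaugeN; apply: gauge_weaken; first exact: ltW.
rewrite [in leRHS](splitr e) EFinD addeA; apply: leeD;
  last by rewrite lee_fin ltW.
rewrite -(subrKC a (alpha n)); apply: nuh.
by rewrite lerBlDl ltW.
Qed.

(** A countable base at [x], the form in which metrizability is used: the sets [V N] decrease and
    eventually control each defining gauge. *)
Lemma nbhs_Snu (x : S) (U : set S) : nbhs x U -> exists N : nat, forall y : S,
  (forall n m, (n <= N)%N -> (m <= N)%N ->
    (gauge (alpha n) (nu (alpha n) + (eps m)%:num%:E) (val x - val y)%R
      < (N.+1%:R^-1)%:E)%E) -> U y.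
Proof.
pose V N := [set y : S | forall n m, (n <= N)%N -> (m <= N)%N ->
  (gauge (alpha n) (nu (alpha n) + (eps m)%:num%:E) (val x - val y)%R
    < (N.+1%:R^-1)%:E)%E].
have VS N M : (N <= M)%N -> V M `<=` V N.
  move=> NM y VMy n m nN mN; have := VMy n m (leq_trans nN NM)
    (leq_trans mN NM).
  move=> /lt_le_trans; apply; rewrite lee_fin lef_pV2 ?posrE ?ltr0n//.
  by rewrite ler_nat ltnS.
pose G := filter_from [set: nat] V.
have FG : Filter G.
  apply: filter_from_filter; first by exists 0%N.
  move=> N M _ _; exists (maxn N M) => // y Vy; split; apply: VS Vy.
    exact: leq_maxl.
  exact: leq_maxr.
have Gx : G --> x.
  apply: (@cvg_Snu R nu alpha eps _ _ FG id) => -[n m] r r0 /=.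
  have [N Nr] : exists N : nat, N.+1%:R^-1 < r.
    exists (Num.truncn r^-1); rewrite invf_plt ?posrE//.
    exact: truncnS_gt.
  exists (maxn N (maxn n m)) => // y /(_ n m).
  rewrite !leq_max !leqnn !orbT => /(_ isT isT) /lt_trans; apply.
  rewrite lte_fin (le_lt_trans _ Nr)// lef_pV2 ?posrE ?ltr0n//.
  by rewrite ler_nat ltnS leq_max leqnn.
by move=> /Gx[N _ VU]; exists N => y; exact: VU.
Qed.

(** The gauge is also finite at [a + h], where the threshold is smaller by a factor [2 ^ (h j)];
    half of this exponent absorbs the constant [C]. *)
Lemma gauge_lty_Snu (x : @Omega R) :
  (forall a e, 0 < e -> (gauge a (nu a + e%:E) x < +oo)%E) -> Snu nu x.
Proof.
move=> gx; apply/SnuP => a d d0; have d30 : 0 < d / 3 by rewrite divr_gt0.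
have [h h0 nuh] := profile_le a d30.
have [_ [C xC <-] _] := ereal_inf_lt (gx (a + h) _ d30).
have h20 : 0 < h / 2 by rewrite divr_gt0.
exists (h / 2) => //; near=> j.
apply: (@le_trans _ _ (large_count x j (C * 2 `^ (- (a + h) * j%:R)))%:R%:E).
  rewrite lee_fin ler_nat; apply: large_count_le.
  rewrite (_ : - (a + h / 2) * j%:R = h / 2 * j%:R + - (a + h) * j%:R);
    last first.
    by field.
  rewrite powRD ?pnatr_eq0 ?implybT// ler_wpM2r ?powR_ge0//.
  by near: j; exact: near_le_pow2.
apply: (le_trans (xC.2 j)).
(* One third pays for [nu (a + h)], one for the margin of the gauge, one for the factor [C]. *)
rewrite (_ : d%:E = (d / 3)%:E + (d / 3)%:E + (d / 3)%:E)%E; last first.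
  by rewrite -!EFinD; congr EFin; field.
rewrite !addeA [in leRHS]powe2D [leRHS]muleC; apply: lee_pmul.
- by rewrite lee_fin xC.1.
- exact: powe2_ge0.
- by rewrite lee_fin; near: j; exact: near_le_pow2.
- by apply: powe2_le; rewrite leeD2r// nuh.
Unshelve. all: by end_near. Qed.

Lemma near_coord (i : wavelet_index) r : 0 < r ->
  \forall x \near (0 : S), normc (val x i) < r.
Proof.
case: i => j k r0.
have : (nu 0 + 1%:E < +oo)%E by rewrite lte_add_pinfty ?profile_lty ?ltry.
set b := (nu 0 + 1%:E)%E => bp.
have [p p0 pE] : exists2 p : R, 0 <= p & powe2 b j = p%:E.
  case: b bp => [s| |]//= _; last by exists 0.
  by exists (2 `^ (s * j%:R)) => //; rewrite powR_ge0.
(* The second bound makes [C * p < 1], so no coefficient of level [j] reaches the threshold [C]. *)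
pose C := Num.min r (p + 1)^-1.
have p10 : 0 < p + 1 by rewrite ltr_wpDl.
have C0 : 0 < C by rewrite lt_min r0 invr_gt0.
apply: filterS (near_gauge 0 ltr01 C0) => x /gauge_lt_bound xC.
apply: lt_le_trans (gauge_bound_coord k xC _) _.
  rewrite pE -EFinM lte_fin (@le_lt_trans _ _ ((p + 1)^-1 * p))//.
    by rewrite ler_wpM2r// ge_min lexx orbT.
  by rewrite mulrC ltr_pdivrMr// mul1r ltrDl.
by rewrite oppr0 mul0r powRr0 mulr1 ge_min lexx.
Qed.

End Snu_topology.

(** * Slopes of the profile and p_0 *)

Section slope.
Context {R : realType}.
Implicit Types (nu : R -> \bar R) (a h p s : R).

Lemma lt_slope p h s (y : \bar R) : 0 < h ->
  (p%:E < (y - s%:E) / h%:E)%E = ((s + p * h)%:E < y)%E.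
Proof.
move=> h0; rewrite inver gt_eqF// lte_pdivlMr// -EFinM.
by rewrite lteBrDl// -EFinD.
Qed.

Lemma right_inf_derivative_gt nu a s p : nu a = s%:E ->
  (p%:E < right_inf_derivative nu a)%E ->
  exists2 d, 0 < d & forall h, 0 < h < d -> ((s + p * h)%:E < nu (a + h)%R)%E.
Proof.
move=> nua; rewrite /right_inf_derivative /limf_einf lteNr -EFinN.
move=> /ereal_inf_lt[_ [V [d /= d0 dV] <-]] Vp; exists d => // h /andP[h0 hd].
rewrite -lt_slope// -lteN2; apply: le_lt_trans Vp.
apply: ereal_sup_ubound; exists h; last by rewrite nua.
by apply: dV => //=; rewrite sub0r normrN gtr0_norm.
Qed.

Lemma right_inf_derivative_lt nu a s p : nu a = s%:E ->
  (right_inf_derivative nu a < p%:E)%E ->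
  forall d, 0 < d -> exists2 h, 0 < h < d & (nu (a + h)%R <= (s + p * h)%:E)%E.
Proof.
move=> nua; rewrite /right_inf_derivative /limf_einf lteNl -EFinN => Hp d d0.
have Fd : (0 : R)^'+ `]0, d[%classic.
  exists d => //= h; rewrite /= sub0r normrN => hd h0.
  by rewrite in_itv/= h0 -(gtr0_norm h0).
have : ((- p)%:E < ereal_sup [set - ((nu (a + h)%R - nu a) / h%:E)
  | h in `]0%R, d[])%E.
  by apply: lt_le_trans Hp _; apply: ereal_inf_lbound; exists `]0, d[%classic.
move=> /ereal_sup_gt[_ [h /=] + <-]; rewrite in_itv/= => hd.
rewrite EFinN lteN2 nua => ph; exists h => //.
by rewrite leNgt -lt_slope ?(andP hd).1//; apply/negP => /(lt_trans ph);
  rewrite ltxx.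
Qed.

(** A number [p] strictly between some right-inf derivative and 1 bounds difference quotients at
    arbitrarily small [h]. *)
Lemma p0_lt1 nu : p0 nu <> 1%E -> exists a s p, [/\ nu a = s%:E, 0 <= s < 1,
  p < 1 & forall d, 0 < d -> exists2 h, 0 < h < d & (nu (a + h)%R <= (s + p *
    h)%:E)%E].
Proof.
move=> /eqP p1; have : (p0 nu < 1)%E by rewrite lt_neqAle p1 /p0 ge_min lexx.
rewrite /p0 gt_min ltxx/= => /ereal_inf_lt[_ [a /= + <-]].
move=> /andP[nua0 nua1] d1.
have [s E] : exists s, nu a = s%:E.
  by case: (nu a) nua0 nua1 => [s| |]//; exists s.
have s01 : 0 <= s < 1 by rewrite -lee_fin -lte_fin -E nua0.
have [p [dp p1']] : exists p, (right_inf_derivative nu a < p%:E)%E /\ p < 1.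
  case D : (right_inf_derivative nu a) d1 => [q| |]//=.
    rewrite lte_fin => q1; exists ((q + 1) / 2); rewrite lte_fin.
    by split; lra.
  by move=> _; exists 0; rewrite ltNyr.
by exists a, s, p; split => //; exact: right_inf_derivative_lt.
Qed.

(* The supremum of the points of [a, a'] up to which the slope is at least p
   is attained, because nu is nondecreasing, and cannot be less than a'. *)
Lemma profile_slope nu a a' : admissible_profile nu -> p0 nu = 1%E -> a <= a' ->
  (0 <= nu a)%E -> (nu a' < 1)%E -> (nu a + (a' - a)%:E <= nu a')%E.
Proof.
move=> nuA p01 aa' nua0 nua1.
have nd := profile_nondecreasing nuA.
have nuf x : a <= x -> x <= a' -> nu x = (fine (nu x))%:E /\ 0 <= fine (nu x)
  < 1.
  move=> ax xa'.
  have := le_trans nua0 (nd _ _ ax); have := le_lt_trans (nd _ _ xa') nua1.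
  case: (nu x) => [s| |]//=; first by rewrite lee_fin lte_fin => -> ->.
pose f x := fine (nu x).
have [Ea f01] := nuf a (lexx _) aa'.
have [Ea' f01'] := nuf a' aa' (lexx _).
rewrite Ea Ea' -EFinD lee_fin -/(f a) -/(f a').
have ndf x y : a <= x -> x <= y -> y <= a' -> f x <= f y.
  move=> ax xy ya'; have [Ex _] := nuf x ax (le_trans xy ya').
  have [Ey _] := nuf y (le_trans ax xy) ya'.
  by rewrite -lee_fin -Ex -Ey; exact: nd.
(* The derivative is known to exceed [p] strictly only for [p < 1]. If slope 1 failed, the mean
   slope [q] would be below 1, and [p = (q + 1) / 2] would give a contradiction. *)
suff H p : 0 < p -> p < 1 -> f a + p * (a' - a) <= f a'.
  rewrite leNgt; apply/negP => fa.
  have [aE|/negPf ana'] := eqVneq a a'; first by move: fa; rewrite aE; lra.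
  have aLt : a < a' by rewrite lt_neqAle ana'.
  pose q := (f a' - f a) / (a' - a).
  have qE : q * (a' - a) = f a' - f a by rewrite divfK// subr_eq0 eq_sym ana'.
  have q1 : q < 1 by rewrite ltr_pdivrMr ?subr_gt0//; lra.
  have q0 : 0 <= q by rewrite divr_ge0 ?subr_ge0// ndf.
  have : f a + (q + 1) / 2 * (a' - a) <= f a' by apply: H; lra.
  have : 0 < (1 - q) * (a' - a) by rewrite mulr_gt0// subr_gt0.
  by nra.
move=> p_gt0 p_lt1.
pose A := [set x | a <= x <= a' /\ f a + p * (x - a) <= f x].
have Aa : A a by split; [rewrite lexx|rewrite subrr mulr0 addr0].
have supA : has_sup A by split; [exists a|exists a' => x [/andP[]]].
pose c := sup A.
have ac : a <= c by apply: sup_upper_bound.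
have ca' : c <= a' by apply: sup_le_ub; [exists a|move=> x [/andP[]]].
have Ac : f a + p * (c - a) <= f c.
  rewrite leNgt; apply/negP => cf.
  (* Each [x] in [A] has [f a + p * (x - a) <= f x <= f c], hence lies below [c] by at least this
     number. *)
  have e0 : 0 < (f a + p * (c - a) - f c) / p by rewrite divr_gt0// subr_gt0.
  have [x Ax xc] := sup_adherent e0 supA; rewrite -/c in xc.
  have xc' : x <= c by apply: sup_upper_bound.
  case: Ax => /andP[ax xa'] fx.
  have := ndf x c ax xc' ca'.
  move: xc; rewrite ltrBlDr -ltrBlDl ltr_pdivlMr//; nra.
suff -> : a' = c by [].
apply/eqP; rewrite eq_le ca' andbT leNgt; apply/negP => ca.
have [Ec c01] := nuf c ac ca'.
have [|d d0 Hd] := @right_inf_derivative_gt nu c (f c) p Ec.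
  have : (1 <= p0 nu)%E by rewrite p01.
  rewrite /p0 le_min => /andP[_ H1].
  apply: (@lt_le_trans _ _ 1%E); first by rewrite lte_fin.
  apply: (le_trans H1); apply: ereal_inf_lbound; exists c => //=;
    rewrite Ec lee_fin lte_fin; exact: c01.
pose h := Num.min (d / 2) (a' - c).
have h0 : 0 < h by rewrite lt_min divr_gt0//= subr_gt0.
have hd : h < d by rewrite gt_min gtr_pMr// invf_lt1// ltr1n.
have ha' : c + h <= a' by rewrite -lerBrDl ge_min lexx orbT.
have ach : a <= c + h by rewrite (le_trans ac)// lerDl ltW.
have [Ech _] := nuf (c + h) ach ha'.
have := Hd h; rewrite h0 hd => /(_ isT); rewrite Ech lte_fin -/(f _) => fch.
have : c + h <= c.
  apply: sup_upper_bound => //; split; first by rewrite ach.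
  by rewrite addrAC mulrDr; lra.
by rewrite gerDl leNgt h0.
Qed.

End slope.

(** * Complex moduli *)

Section complex_norm.
Context {R : realType}.

Lemma normr_normc (z : R[i]) : `|z| = ((normc z)%:C)%C.
Proof. by []. Qed.

(** Positivity in the order of [R[i]] entails reality, so complex radii reduce to real ones. *)
Lemma gt0_complex (e : R[i]) : 0 < e -> exists2 r : R, 0 < r & e = (r%:C)%C.
Proof.
move=> e0; have /complex_realP[r er] := gtr0_real e0.
by exists r => //; rewrite -ltcR -er.
Qed.

Lemma normc_sum (I : Type) (r : seq I) (P : pred I) (F : I -> R[i]) :
  normc (\sum_(i <- r | P i) F i) <= \sum_(i <- r | P i) normc (F i).
Proof.
elim/big_ind2 : _ => [|u p v q up vq|//]; first by rewrite normc0.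
exact: le_trans (le_normcD _ _) (lerD up vq).
Qed.

Lemma normc_real (r : R) : normc (r%:C)%C = `|r|.
Proof. by rewrite /normc /= expr0n /= addr0 sqrtr_sqr. Qed.

Lemma normc_phase (z : R[i]) :
  exists2 u : R[i], normc u <= 1 & u * z = ((normc z)%:C)%C.
Proof.
have [->|z0] := eqVneq z 0; first by exists 0; rewrite ?normc0 ?mul0r.
exists ((normc z)%:C / z)%C; last by rewrite divfK.
rewrite normcM normcV normc_real ger0_norm ?normc_ge0// divff//.
by apply: contra z0 => /eqP/eq0_normc ->.
Qed.

End complex_norm.

(** * Finitely supported forms on one level *)

Section level_functionals.
Context {R : realType}.
Implicit Types (x : @Omega R) (s : seq (R[i] * wavelet_index)) (j : nat).

(** A finitely supported sequence is encoded as a list of coefficients with their indices; repeated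
    indices add up. *)
Definition pairing s x : R[i] := \sum_(q <- s) q.1 * x q.2.

Lemma pairingB s x y : pairing s (x - y) = pairing s x - pairing s y.
Proof.
rewrite /pairing -sumrB; apply: eq_bigr => q _; rewrite -mulrBr; congr (_ * _).
Qed.

Lemma pairingD s x y : pairing s (x + y) = pairing s x + pairing s y.
Proof.
rewrite /pairing -big_split/=; apply: eq_bigr => q _; rewrite -mulrDr;
  congr (_ * _).
Qed.

Lemma pairingZ s (t : R[i]) x : pairing s (t *: x) = t * pairing s x.
Proof.
by rewrite /pairing mulr_sumr; apply: eq_bigr => q _; rewrite mulrCA.
Qed.

Definition level_seq j (c : 'I_(2 ^ j) -> R[i]) : seq (R[i] * wavelet_index) :=
  [seq (c k, existT _ j k) | k <- enum 'I_(2 ^ j)].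

Lemma pairing_level j (c : 'I_(2 ^ j) -> R[i]) x :
  pairing (level_seq c) x = \sum_k c k * x (existT _ j k).
Proof. by rewrite /pairing big_map big_enum. Qed.

(* The unit ball of the dual of the norm of the j-th level which is
   L 2 ^ (a j) times the mean of the 2 ^ (b j) largest moduli. *)
Definition level_ball (P : set nat) (a : R) (b : \bar R) (L : R) :
    set (seq (R[i] * wavelet_index)) :=
  [set s | exists2 j, P j & exists2 c : 'I_(2 ^ j) -> R[i], s = level_seq c &
    (forall k, ((normc (c k))%:E * powe2 b j <= (L * 2 `^ (a * j%:R))%:E)%E) /\
    \sum_k normc (c k) <= L * 2 `^ (a * j%:R)].

(** If the count [n] were too large, weights of equal modulus on the counted coefficients, with
    phases making all products positive, would form a member of the ball whose pairing with [x] is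
    at least 2. *)
Lemma level_ball_count (P : set nat) (a : R) (b : \bar R) (r : R) x j :
  0 < r <= 1 -> P j ->
  (forall s, level_ball P a b (2 / r ^+ 2) s -> normc (pairing s x) <= 1) ->
  ((large_count x j (r * 2 `^ (- a * j%:R)))%:R%:E <= r%:E * powe2 b j)%E.
Proof.
move=> /andP[r0 r1] Pj xb; rewrite leNgt; apply/negP => rn.
set n := large_count _ _ _ in rn.
have n0 : 0 < n%:R :> R.
  by rewrite -lte_fin (le_lt_trans _ rn)// mule_ge0 ?lee_fin ?powe2_ge0// ltW.
have [p p0 pE] : exists2 p : R, 0 <= p & powe2 b j = p%:E.
  case: b {xb} rn => [s| |]//=; last by exists 0.
    by exists (2 `^ (s * j%:R)) => //; rewrite powR_ge0.
  by rewrite gt0_muley ?lte_fin// ltNge leey.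
move: rn; rewrite pE -EFinM lte_fin => rn.
set L := 2 / r ^+ 2; set A := 2 `^ (a * j%:R).
have A0 : 0 < A by rewrite powR_gt0.
have L0 : 0 < L by rewrite divr_gt0// exprn_gt0.
pose y k := x (existT _ j k).
have /choice[u Hu] : forall k, exists u : R[i],
  normc u <= 1 /\ u * y k = ((normc (y k))%:C)%C.
  by move=> k; have [v v1 vz] := normc_phase (y k); exists v.
pose T := [pred k : 'I_(2 ^ j) | r * 2 `^ (- a * j%:R) <= normc (y k)].
have nE : n = #|T| by [].
(* The total mass is [L * A * r <= L * A], and [w * p <= L * A] because [r * p < n]. The pairing is
   at least [n * w * r / A = L * r ^+ 2 = 2]. *)
pose w := L * A * r / n%:R.
have w0 : 0 < w by apply: divr_gt0 => //; do 2?apply: mulr_gt0.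
pose c k := if k \in T then (w%:C)%C * u k else 0.
have cw k : normc (c k) <= if k \in T then w else 0.
  rewrite /c; case: ifP => _; last by rewrite normc0.
  rewrite normcM normc_real gtr0_norm// ger_pMr//; exact: (Hu k).1.
have /xb : level_ball P a b L (level_seq c).
  exists j => //; exists c => //; split=> [k|].
    rewrite pE -EFinM lee_fin (@le_trans _ _ (w * p))//.
      by apply: ler_wpM2r => //; apply: le_trans (cw k) _; case: ifP => // _;
        exact: ltW.
    rewrite /w -/A (_ : L * A * r / n%:R * p = L * A * (r * p) / n%:R);
      last by ring.
    by rewrite ler_pdivrMr// ler_pM2l ?(mulr_gt0 L0 A0)//; exact: ltW.
  apply: le_trans (ler_sum _ (fun k _ => cw k)) _.
  rewrite -big_mkcond/= sumr_const -nE -[w *+ n]mulr_natr /w divfK ?gt_eqF//.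
  by rewrite ger_pMr ?(mulr_gt0 L0 A0).
rewrite pairing_level leNgt => /negP; apply.
have -> : \sum_k c k * x (existT _ j k) = ((\sum_(k in T)
  w * normc (y k))%:C)%C.
  rewrite rmorph_sum [RHS]big_mkcond/=; apply: eq_bigr => k _.
  rewrite /c; case: ifP => _; last by rewrite mul0r.
  by rewrite -mulrA (Hu k).2; exact/esym/rmorphM.
rewrite normc_real ger0_norm; last first.
  by apply: sumr_ge0 => k _; rewrite mulr_ge0 ?normc_ge0// ltW.
apply: (@lt_le_trans _ _ (\sum_(k in T) w * (r * 2 `^ (- a * j%:R)))).
  rewrite sumr_const -nE -[_ *+ n]mulr_natr mulNr powRN -/A.
  rewrite (_ : _ * n%:R = 2); first by rewrite ltr1n.
  by rewrite /w /L; field; rewrite !gt_eqF.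
by apply: ler_sum => k kT; rewrite ler_pM2l.
Qed.

(** For the last [i < N] with [t i <= y], the term [t i.+1] exceeds [y]; if there is none, [t 0]
    does. *)
Lemma layer_cake_le (t : nat -> R) N (y : R) :
  (forall i, 0 <= t i) -> y < t N ->
  y <= t 0%N + \sum_(i < N) (if t i <= y then t i.+1 else 0).
Proof.
move=> t0; elim: N y => [|N IH] y yt; first by rewrite big_ord0 addr0 ltW.
rewrite big_ord_recr/=; have [ty|/IH H] := leP (t N) y; last by rewrite addr0.
rewrite addrA ler_wpDl ?(ltW yt)// addr_ge0//; apply: sumr_ge0 => i _.
by case: ifP.
Qed.

(** Apply the layer cake to each modulus and exchange the sums: layer [i] involves [n] coefficients,
    each contributing at most [M / n]. *)
Lemma level_pairing_le j (c : 'I_(2 ^ j) -> R[i]) x (t : nat -> R) (M : R) N :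
  0 <= M -> (forall i, 0 <= t i) ->
  (forall k, normc (x (existT _ j k)) < t N) ->
  (forall i k, (i < N)%N -> normc (c k) * (t i.+1 * (large_count x j (t i))%:R)
    <= M) ->
  normc (pairing (level_seq c) x) <= (\sum_k normc (c k)) * t 0%N + N%:R * M.
Proof.
move=> M0 t0 xt cM.
rewrite pairing_level; apply: le_trans (normc_sum _ _ _) _.
pose y k := normc (x (existT _ j k)).
apply: (@le_trans _ _ (\sum_k normc (c k) *
    (t 0%N + \sum_(i < N) (if t i <= y k then t i.+1 else 0)))).
  apply: ler_sum => k _; rewrite normcM ler_wpM2l ?normc_ge0//.
  exact: layer_cake_le.
under eq_bigr do rewrite mulrDr.
rewrite big_split/= -mulr_suml lerD2l.
under eq_bigr do rewrite mulr_sumr.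
rewrite exchange_big/= mulr_natl -[N in leRHS]card_ord -sumr_const.
apply: ler_sum => i _; pose n := large_count x j (t i).
have nE : n = #|[pred k | t i <= y k]| by [].
rewrite (eq_bigr (fun k => if t i <= y k then normc (c k) * t i.+1 else 0));
  last first.
  by move=> k _; case: ifP => _; rewrite ?mulr0.
rewrite -big_mkcond/=; case: (posnP n) => [n0|n0].
  rewrite big_pred0// => k; apply/negbTE/negP => tk.
  by move/card0_eq : (n0) => /(_ k); rewrite inE tk.
have n0R : 0 < n%:R :> R by rewrite ltr0n.
apply: (@le_trans _ _ (\sum_(k | t i <= y k) M / n%:R)).
  by apply: ler_sum => k _; rewrite ler_pdivlMr// -mulrA; exact: cM.
by rewrite sumr_const -[X in _ *+ X]nE -[_ *+ n]mulr_natr divfK ?gt_eqF.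
Qed.

End level_functionals.

(** * Polar neighbourhoods inside the gauge balls *)

Section polar_neighbourhoods.
Context {R : realType} {nu : R -> \bar R} {alpha : nat -> R}
  {eps : nat -> {posnum R}}.
Context (nu_admissible : admissible_profile nu)
  (alpha_dense : dense (range alpha))
  (eps_cvg0 : (eps m)%:num @[m --> \oo] --> (0 : R)).
Local Notation S := (Snu_space nu alpha eps).
Implicit Types (a e r : R).

Lemma large_count_max (x : @Omega R) j (t : R) : (large_count x j t <= 2 ^ j)%N.
Proof. by rewrite -[leqRHS]card_ord; exact: max_card. Qed.

(** On finitely many levels a small gauge makes every coefficient small, so the bottom layer alone
    gives the estimate. *)
Lemma near_level_ball_max (J : nat) a e L : 0 < e -> 0 < L -> nu a = 1%E ->
  \forall x \near (0 : S), forall s,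
    level_ball [set j | (j < J)%N] a (nu a + e%:E) L s ->
    normc (pairing s (val x)) <= 1.
Proof.
move=> e0 L0 nu1; have e1 : 0 <= 1 + e by rewrite addr_ge0// ltW.
pose D : R := 2 `^ ((1 + e) * J%:R).
have D0 : 0 < D by rewrite powR_gt0.
(* The second bound puts all coefficients of levels below [J] under the threshold; the first gives
   [L * C <= 1]. *)
pose C := Num.min L^-1 (D^-1 / 2).
have C0 : 0 < C by rewrite lt_min invr_gt0 L0/= divr_gt0// invr_gt0.
apply: filterS (near_gauge nu_admissible alpha_dense eps_cvg0 a e0 C0) => x.
move=> /gauge_lt_bound xC _ [j /= jJ [c -> [_ cL]]].
pose t i := if i is 0%N then C * 2 `^ (- a * j%:R) else 0.
apply: le_trans (@level_pairing_le R j c (val x) t 0 0 _ _ _ _) _ => //.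
- by case=> [|n]//=; rewrite mulr_ge0 ?powR_ge0// ltW.
- move=> k; apply: gauge_bound_coord xC _.
  rewrite nu1 -EFinD/= -EFinM lte_fin (@le_lt_trans _ _ (C * D))//.
    by rewrite ler_wpM2l ?(ltW C0)//; apply: ler_powR;
      rewrite ?ler1n// ler_wpM2l// ler_nat ltnW.
  rewrite -ltr_pdivlMr// mul1r gt_min orbC ltr_pdivrMr// ltr_pMr ?ltr1n//.
  by rewrite invr_gt0.
- rewrite mulr0 addr0 /=; apply: (@le_trans _ _ (L * 2 `^ (a * j%:R)
  * (C * 2 `^ (- a * j%:R)))).
    by rewrite ler_wpM2r// mulr_ge0 ?powR_ge0// ltW.
  rewrite mulNr powRN mulrACA divff ?mulr1 ?gt_eqF ?powR_gt0//.
  by rewrite -ler_pdivlMl// mulr1 ge_min lexx.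
Qed.

(* Moduli between d 2^(-(a - i h) j) and d 2^(-(a - (i + 1) h) j) are counted by
   the gauge at a - i h; none exceeds the last threshold, as nu (a - N h)
     = -oo. *)
Lemma near_level_ball_slope a e L : p0 nu = 1%E -> 0 < e -> 0 < L ->
  (nu a < 1)%E -> \forall x \near (0 : S), forall s,
    level_ball setT a (nu a + e%:E) L s -> normc (pairing s (val x)) <= 1.
Proof.
(* One [h] pays for the margin of the gauges, the other for the ratio [2 ^ (h j)] of consecutive
   thresholds. *)
move=> p01 e0 L0 nu1; pose h := e / 2.
have h0 : 0 < h by rewrite divr_gt0.
have hh : h + h = e by rewrite -splitr.
(* As [N * h >= 1] and [nu a < 1], slope 1 would make [nu] negative at [a - N * h]. *)
pose N := (Num.truncn h^-1).+1.
have Nh : 1 <= N%:R * h by rewrite -ler_pdivrMr// mul1r ltW// truncnS_gt.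
have slope i : (0 <= nu (a - i%:R * h)%R)%E ->
    (nu (a - i%:R * h)%R + (i%:R * h)%:E <= nu a)%E.
  move=> nu0; have := profile_slope nu_admissible p01 _ nu0 nu1.
  rewrite subKr; apply; rewrite gerBl mulr_ge0// ltW//.
have nuN : nu (a - N%:R * h)%R = -oo%E.
  have [//|/andP[nu0 _]] := profile_range nu_admissible (a - N%:R * h)%R.
  have := le_lt_trans (slope N nu0) nu1; move: nu0.
  case: (nu (a - N%:R * h)%R) => [q| |]//=.
  rewrite -EFinD lee_fin lte_fin => q0.
  by rewrite ltNge (le_trans Nh)// lerDr.
(* The bottom layer and the [N] others contribute at most [L * d] each. *)
pose d := Num.min 1 (N.+1%:R * L)^-1.
have d0 : 0 < d by rewrite lt_min ltr01 invr_gt0 mulr_gt0.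
have d1 : d <= 1 by rewrite ge_min lexx.
apply: filterS (@filter_forall S 'I_N.+1 _ _ _ (fun i =>
  near_gauge nu_admissible alpha_dense eps_cvg0 (a - i%:R * h) h0 d0)).
move=> x xd _ [j _ [c -> [cb cL]]].
have {}xd i : (i <= N)%N -> gauge_bound (a - i%:R * h)
  (nu (a - i%:R * h)%R + h%:E) (val x) d.
  by move=> iN; apply: gauge_lt_bound; exact: (xd (@Ordinal N.+1 i iN)).
pose t i := d * 2 `^ (- (a - i%:R * h) * j%:R).
have t0 i : 0 <= t i by rewrite mulr_ge0 ?powR_ge0// ltW.
have Ld : 0 <= L * d by rewrite mulr_ge0// ltW.
apply: le_trans (@level_pairing_le R j c (val x) t (L * d) N _ _ _ _) _ => //.
- move=> k; apply: gauge_bound_coord (xd N (leqnn _)) _.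
  by rewrite nuN /= mule0 lte_fin.
- move=> i k iN; have := (xd i (ltnW iN)).2 j; rewrite -/(t i).
  set n := large_count _ _ _.
  have [nuE|/andP[nu0 _]] := profile_range nu_admissible (a - i%:R * h).
    rewrite nuE /= mule0 lee_fin => n0.
    have -> : n%:R = 0 :> R by apply/eqP; rewrite eq_le n0 ler0n.
    by rewrite !mulr0.
  have := slope i nu0; move: (cb k).
  case: (nu (a - i%:R * h)%R) nu0 => [q| |]//= _; last first.
    by rewrite addye// => _; rewrite leye_eq => /eqP E; move: nu1; rewrite E.
  case: (nu a) nu1 => [s| |]//= _.
  rewrite -EFinM -EFinD !lee_fin => cs qs nd.
  apply: (@le_trans _ _ (normc (c k) * (t i.+1 * (d * 2 `^ ((q + h) * j%:R))))).
    by rewrite ler_wpM2l ?normc_ge0// ler_wpM2l.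
  apply: (@le_trans _ _ (normc (c k) * (d * (2 `^ ((s + e) * j%:R)
    * 2 `^ (- a * j%:R))))).
    rewrite ler_wpM2l ?normc_ge0// /t -mulrA ler_wpM2l ?(ltW d0)//.
    rewrite mulrCA -[leRHS]mul1r ler_pM ?mulr_ge0 ?powR_ge0 ?(ltW d0)//.
    rewrite -!powRD ?pnatr_eq0 ?implybT//; apply: ler_powR; rewrite ?ler1n//.
    rewrite -!mulrDl ler_wpM2r// -[i.+1]addn1 natrD mulrDl mul1r -hh.
    by move: qs; lra.
  rewrite mulrCA mulrA -mulrA [leRHS]mulrC ler_wpM2l ?(ltW d0)//.
  rewrite mulrA mulNr powRN ler_pdivrMr ?powR_gt0//.
- rewrite /t mul0r subr0 mulNr powRN.
  apply: (@le_trans _ _ (L * 2 `^ (a * j%:R) * (d / 2 `^ (a * j%:R))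
    + N%:R * (L * d))).
    by rewrite lerD2r ler_wpM2r// divr_ge0 ?powR_ge0// ltW.
  rewrite mulrACA divff ?mulr1 ?gt_eqF ?powR_gt0//.
  rewrite -[X in X + _]mul1r -mulrDl mulrA -(natrD _ 1 N) add1n.
  rewrite -ler_pdivlMl ?mulr_gt0// mulr1 /d ge_min lexx orbT//.
Qed.

(** A level ball serves as [F]. The second property ranges over all of [Omega], so that it can later
    decide membership in S^nu. *)
Lemma gauge_polar a e r : p0 nu = 1%E -> 0 < e -> 0 < r ->
  exists2 F : set (seq (R[i] * wavelet_index)),
    (\forall x \near (0 : S), forall s, F s -> normc (pairing s (val x)) <= 1) &
    (forall x : @Omega R, (forall s, F s -> normc (pairing s x) <= 1) ->
      (gauge a (nu a + e%:E) x < r%:E)%E).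
Proof.
move=> p01 e0 r0; pose d := Num.min (r / 2) 1.
have d0 : 0 < d by rewrite lt_min ltr01 divr_gt0.
have d01 : 0 < d <= 1 by rewrite d0 ge_min lexx orbT.
have dr : d < r by rewrite gt_min gtr_pMr// invf_lt1// ltr1n.
pose L := 2 / d ^+ 2.
have L0 : 0 < L by rewrite divr_gt0// exprn_gt0.
have [nu1|nu1] := ltP (nu a) 1%E.
  exists (level_ball setT a (nu a + e%:E) L);
    first exact: near_level_ball_slope.
  move=> x xF; apply: (@le_lt_trans _ _ d%:E); last by rewrite lte_fin.
  apply: gauge_bound_gauge; split=> [|j]; first exact: ltW.
  exact: level_ball_count xF.
have {}nu1 : nu a = 1%E.
  have [nua|/andP[_ nua]] := profile_range nu_admissible a; first by move: nu1;
    rewrite nua.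
  by apply/eqP; rewrite eq_le nua.
(* From level [J] on, even the full count [2 ^ j] is at most [d * 2 ^ ((1 + e) j)], so only the
   lower levels need testing. *)
have [J _ HJ] := near_le_pow2 d^-1 e0.
exists (level_ball [set j | (j < J)%N] a (nu a + e%:E) L).
  exact: near_level_ball_max.
move=> x xF; apply: (@le_lt_trans _ _ d%:E); last by rewrite lte_fin.
apply: gauge_bound_gauge; split=> [|j]; first exact: ltW.
have [jJ|Jj] := ltnP j J; first exact: level_ball_count xF.
apply: (@le_trans _ _ (2 ^ j)%:R%:E);
  first by rewrite lee_fin ler_nat large_count_max.
rewrite nu1 powe2D /= mul1r powR_mulrn// -natrX muleCA -[leLHS]mule1.
apply: lee_wpmul2l; first by rewrite lee_fin.
rewrite -EFinM lee_fin mulrC -ler_pdivrMr// mul1r.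
exact: (HJ j Jj).
Qed.

End polar_neighbourhoods.

(** * Truncation and density of the finitely supported forms *)

Section truncation.
Context {R : realType} {nu : R -> \bar R} {alpha : nat -> R}
  {eps : nat -> {posnum R}}.
Context (nu_admissible : admissible_profile nu)
  (alpha_dense : dense (range alpha))
  (eps_cvg0 : (eps m)%:num @[m --> \oo] --> (0 : R)).
Local Notation S := (Snu_space nu alpha eps).
Implicit Types (a e r : R) (x : @Omega R) (B : set S) (f : strong_dual S).

Lemma coord_continuous_form (i : wavelet_index) :
  (fun x : S => val x i : R[i]^o) \in @continuous_form R[i] S.
Proof.
apply: continuous_formP; first by [].
move=> _ /gt0_complex[r r0 ->].
apply: filterS (near_coord nu_admissible alpha_dense eps_cvg0 i r0) => x.
by rewrite normr_normc ltcR.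
Qed.

Definition coord (i : wavelet_index) : strong_dual S :=
  exist (fun f : S -> R[i]^o => f \in @continuous_form R[i]
    S) (fun x : S => val x i : R[i]^o)
    (coord_continuous_form i).

Definition form (s : seq (R[i] * wavelet_index)) : strong_dual S :=
  \sum_(q <- s) q.1 *: coord q.2.

Lemma formE s (x : S) : val (form s) x = pairing s (val x).
Proof.
rewrite /form /pairing; elim: s => [|q s IH]; first by rewrite !big_nil.
by rewrite !big_cons -IH.
Qed.

Definition trunc (J : nat) x : @Omega R := fun i =>
  if (tag i < J)%N then x i else 0.

Lemma trunc_Snu J x : Snu nu (trunc J x).
Proof.
apply/SnuP => a d d0; exists 1 => //; near=> j.
rewrite large_count_eq0 ?powe2_ge0// => k.
have Jj : (J <= j)%N by near: j; exists J.
by rewrite /trunc ltnNge Jj normc0 powR_gt0.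
Unshelve. all: by end_near. Qed.

(** Besides truncating, this places in S^nu any sequence that vanishes from level [J] on, such as
    unit vectors and blocks. *)
Definition Snu_trunc J x : S := exist (fun y =>
  y \in Snu nu) (trunc J x) (mem_set (trunc_Snu J x)).

Definition unit_vector (i : wavelet_index) : @Omega R := fun i' => (i' == i)%:R.

Definition index_below (J : nat) : seq wavelet_index :=
  [seq existT (fun j => 'I_(2 ^ j)) j k | j <- iota 0 J, k <- enum 'I_(2 ^ j)].

Lemma mem_index_below J i : (i \in index_below J) = (tag i < J)%N.
Proof.
apply/allpairsPdep/idP => [[j [k [jJ _ ->]]]|]; first by rewrite mem_iota in jJ.
by case: i => j k /= jJ; exists j, k; rewrite mem_iota mem_enum.
Qed.

Lemma index_below_uniq J : uniq (index_below J).
Proof.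
apply: allpairs_uniq_dep; first exact: iota_uniq.
  by move=> j _; exact: enum_uniq.
by move=> [j k] [j' k'] _ _ /= H; exact: H.
Qed.

Lemma Snu_truncE J x : Snu_trunc J x =
  \sum_(i <- index_below J) x i *: Snu_trunc (tag i).+1 (unit_vector i).
Proof.
apply/val_inj; rewrite raddf_sum/=; apply/funext => i.
rewrite fct_sumE /trunc -mem_index_below.
have step i' : (val (x i' *: Snu_trunc (tag i').+1 (unit_vector i'))
  : @Omega R) i
    = if i' == i then x i else 0.
  rewrite /= /trunc /unit_vector /= fctE eq_sym.
  by case: eqVneq => [->|_]; rewrite ?ltnS ?leqnn;
    [exact: mulr1|case: ifP => _; exact: mulr0].
rewrite (eq_bigr (fun i' => if i' == i then x i else 0)); last by move=> i' _;
  exact: step.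
rewrite -big_mkcond/=; case: ifPn => [iJ|iJ].
  by rewrite (big_rem i iJ)/= eqxx big1_seq ?addr0// => i';
    rewrite mem_rem_uniq ?index_below_uniq// inE /= => /andP[/eqP->];
    rewrite eqxx.
by rewrite big1_seq// => i' /andP[/eqP->]; rewrite (negPf iJ).
Qed.

Definition coefs f (J : nat) : seq (R[i] * wavelet_index) :=
  [seq (val f (Snu_trunc (tag i).+1 (unit_vector i)), i) | i <- index_below J].

Lemma strong_dual_sum f (I : Type) (s : seq I) (c : I -> R[i]) (z : I -> S) :
  val f (\sum_(i <- s) c i *: z i) = \sum_(i <- s) c i * val f (z i).
Proof.
elim: s => [|i s IH]; first by rewrite !big_nil strong_dual0.
by rewrite !big_cons strong_dual_linear IH.
Qed.

Lemma pairing_coefs f J x : pairing (coefs f J) x = val f (Snu_trunc J x).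
Proof.
rewrite Snu_truncE strong_dual_sum /pairing big_map.
by apply: eq_bigr => i _; rewrite mulrC.
Qed.

(** [B] lies in [r] times a unit gauge ball, and multiplication by [r] changes only the threshold:
    [M = r]. *)
Lemma vN_bounded_count B a e : vN_bounded B -> 0 < e ->
  exists2 M : R, 0 < M & forall x : S, B x -> forall j,
    ((large_count (val x) j (M * 2 `^ (- a * j%:R)))%:R%:E <= powe2 (nu a +
      e%:E) j)%E.
Proof.
move=> bB e0.
have [_ /gt0_complex[r r0 ->]] :=
  bB _ (near_gauge nu_admissible alpha_dense eps_cvg0 a e0 ltr01).
move=> /(_ (r%:C)%C); rewrite normr_normc normc_real gtr0_norm// =>
  /(_ (lexx _)) Br.
exists r => // x /Br[u /= /gauge_lt_bound[_ u1] <-] j.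
apply: le_trans (le_trans _ (u1 j)) _; last by rewrite mul1e.
rewrite lee_fin ler_nat mul1r.
apply: (leq_trans (@large_countZ _ (r%:C)%C (val u) j _ r r0 _)).
  by rewrite normc_real gtr0_norm.
by rewrite mulrAC divff ?gt_eqF// mul1r.
Qed.

(** The uniform count is taken at [a + h]: on high levels its threshold falls below
    [r / 2 * 2 ^ (- a j)], and the margin in [e] yields the factor [r / 2]. *)
Lemma near_trunc_gauge B a e r : vN_bounded B -> 0 < e -> 0 < r ->
  \forall J \near \oo, forall x : S, B x ->
    (gauge a (nu a + e%:E) (val x - trunc J (val x))%R < r%:E)%E.
Proof.
move=> bB e0 r0; have e30 : 0 < e / 3 by rewrite divr_gt0.
have [h h0 nuh] := profile_le nu_admissible a e30.
have [M M0 BM] := vN_bounded_count (a + h) bB e30.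
have r20 : 0 < r / 2 by rewrite divr_gt0.
have [J1 _ HJ1] := near_le_pow2 (M / (r / 2)) h0.
have [J2 _ HJ2] := near_le_pow2 (r / 2)^-1 e30.
exists (maxn J1 J2) => // J /=; rewrite geq_max => /andP[J1J J2J] x Bx.
apply: (@le_lt_trans _ _ (r / 2)%:E); last first.
  by rewrite lte_fin gtr_pMr// invf_lt1// ltr1n.
apply: gauge_bound_gauge; split=> [|j]; first exact: ltW.
have [jJ|Jj] := ltnP j J.
  rewrite large_count_eq0 ?mule_ge0 ?powe2_ge0 ?lee_fin ?(ltW r20)// => k.
  rewrite !fctE /trunc jJ subrr. by rewrite normc0 mulr_gt0// powR_gt0.
apply: (@le_trans _ _ (large_count (val x) j (M * 2 `^ (- (a + h)
  * j%:R)))%:R%:E).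
  rewrite lee_fin ler_nat.
  apply: (@leq_trans (large_count (val x) j (r / 2 * 2 `^ (- a * j%:R)))).
    apply: subset_leq_card; apply/fintype.subsetP => k.
    rewrite !inE !fctE /trunc ltnNge Jj. by rewrite subr0.
  apply: large_count_le.
  rewrite opprD mulrDl powRD ?pnatr_eq0 ?implybT//
    mulrA mulrAC ler_wpM2r ?powR_ge0//.
  rewrite mulNr powRN ler_pdivrMr ?powR_gt0// mulrC -ler_pdivrMr//.
  exact: HJ1 (leq_trans J1J Jj).
apply: (le_trans (BM x Bx j)).
rewrite (_ : e%:E = (e / 3)%:E + (e / 3)%:E + (e / 3)%:E)%E; last first.
  by rewrite -!EFinD; congr EFin; field.
rewrite !addeA [in leRHS]powe2D muleCA -[leLHS]mule1; apply: lee_pmul => //.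
- exact: powe2_ge0.
- by apply: powe2_le; rewrite leeD2r// nuh.
- rewrite -EFinM lee_fin mulrC -ler_pdivrMr// mul1r.
  exact: HJ2 (leq_trans J2J Jj).
Qed.

Lemma near_trunc B (U : set S) : vN_bounded B -> nbhs 0 U ->
  exists J, forall x : S, B x -> U (x - Snu_trunc J (val x)).
Proof.
move=> bB /nbhs_Snu[N NU].
have N0 : (0 : R) < N.+1%:R^-1 by rewrite invr_gt0.
have H : \forall J \near \oo, forall (n m : 'I_N.+1) (x : S), B x ->
    (gauge (alpha n) (nu (alpha n) + (eps m)%:num%:E)
      (val x - trunc J (val x))%R < (N.+1%:R^-1)%:E)%E.
  apply: (@filter_forall nat 'I_N.+1) => n;
    apply: (@filter_forall nat 'I_N.+1) => m.
  exact: near_trunc_gauge.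
have [J HJ] := filter_ex H; exists J => x Bx; apply: NU => n m nN mN.
rewrite sub0r gaugeN.
exact: (HJ (@Ordinal N.+1 n nN) (@Ordinal N.+1 m mN) x Bx).
Qed.

(** The forms [f] and [form (coefs f J)] differ at [x] by the value of [f] at [x] minus its
    truncation, which is small uniformly on [B]. *)
Lemma form_dense f (U : set (strong_dual S)) : nbhs f U -> exists s, U (form s).
Proof.
move=> /nbhs_strong_dual[B bB [e e0 BU]].
have fe : \forall x \near (0 : S), `|val f x| < e.
  have /cvgrPdist_lt/(_ e e0) := @strong_dual_continuous _ _ f 0.
  by apply: filterS => x; rewrite strong_dual0 sub0r normrN.
have [J HJ] := near_trunc bB fe.
exists (coefs f J); apply: BU => x Bx.
by rewrite formE pairing_coefs -strong_dualB; exact: HJ.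
Qed.

End truncation.

(** * Equicontinuity of bounded sets of forms *)

Section barrelled.
Context {R : realType} {nu : R -> \bar R} {alpha : nat -> R}
  {eps : nat -> {posnum R}}.
Context (nu_admissible : admissible_profile nu)
  (alpha_dense : dense (range alpha))
  (eps_cvg0 : (eps m)%:num @[m --> \oo] --> (0 : R)).
Local Notation S := (Snu_space nu alpha eps).

(** Gauge balls are balanced, so the tail of the sequence is absorbed as soon as [|t| >= 1]; the
    remaining terms form a finite union of points. *)
Lemma null_sequence_bounded (z : nat -> S) :
  (forall N, exists M, forall n m k, (M <= k)%N -> (n <= N)%N -> (m <= N)%N ->
    (gauge (alpha n) (nu (alpha n) + (eps m)%:num%:E) (val (z k))
      < (N.+1%:R^-1)%:E)%E) ->
  vN_bounded (range z).
Proof.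
move=> zN U U0; have [N NU] := nbhs_Snu U0; have [M HM] := zN N.
have : vN_bounded [set z k | k in [set k | (k < M)%N]].
  elim: M {HM} => [|M IH].
    rewrite (_ : [set _ | _ in _] = set0); last by apply/seteqP;
      split=> // x [].
    exact: (@vN_bounded0 R[i] S).
  rewrite (_ : [set _ | _ in _] = [set z k | k in [set k | (k < M)%N]]
    `|` [set z M]).
    exact: (vN_boundedU IH (@vN_bounded1 R[i] S (z M))).
  apply/seteqP; split=> [_ [k /= kM <-]|x [[k /= kM <-]|->]].
  - by move: kM; rewrite ltnS leq_eqVlt => /orP[/eqP->|kM]; [right|left;
    exists k].
  - by exists k => //=; exact: ltnW.
  - by exists M => /=.
move=> /(_ U U0)[r r0 rU]; exists (1 + r); first by rewrite addr_gt0.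
move=> t tr _ [k _ <-]; have [kM|Mk] := ltnP k M.
  have rt : r <= `|t| by rewrite (le_trans _ tr)// lerDr.
  by apply: (rU t rt); exists k.
have t1 : 1 <= `|t| by rewrite (le_trans _ tr)// lerDl ltW.
have t0 : t != 0 by rewrite -normr_gt0 (lt_le_trans _ t1).
exists (t^-1 *: z k); last by rewrite scalerA divff// scale1r.
apply: NU => n m nN mN; rewrite sub0r gaugeN.
apply: gauge_contract; last exact: HM.
rewrite normcV invf_le1 -?ltcR -?lecR//.
by rewrite -normr_normc (lt_le_trans _ t1).
Qed.

(* Otherwise forms f_N in D and points y_N with |f_N(y_N)| >= e and (N + 1) y_N
   tending to 0 exist, and D is unbounded on the bounded set of the (N + 1)
     y_N. *)
Lemma bounded_dual_equicontinuous (D : set (strong_dual S)) (e : R[i]) :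
  vN_bounded D -> 0 < e ->
  \forall x \near (0 : S), forall f, D f -> `|val f x| < e.
Proof.
move=> bD e0; apply: contrapT => nD.
pose V N := [set x : S | forall n m : 'I_N.+1,
  (gauge (alpha n) (nu (alpha n) + (eps m)%:num%:E) (val x)
    < (N.+1%:R^-1)%:E)%E].
have nV N : nbhs (0 : S) (V N).
  have N0 : (0 : R) < N.+1%:R^-1 by rewrite invr_gt0.
  exact: (@filter_forall S 'I_N.+1 _ _ _ (fun n =>
    @filter_forall S 'I_N.+1 _ _ _
    (fun m => near_gauge nu_admissible alpha_dense eps_cvg0 (alpha n)
      (gt0 (eps m)) N0))).
have /choice[yf Hyf] : forall N, exists yf : S * strong_dual S,
    [/\ V N (N.+1%:R *: yf.1), D yf.2 & e <= `|val yf.2 yf.1|].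
  move=> N; apply: contrapT => H; apply: nD.
  apply: filterS (nbhs0_scale N.+1%:R (nV N)) => y Vy f Df.
  have [//|ey] := real_ltP (normr_real (val f y)) (gtr0_real e0).
  by exfalso; apply: H; exists (y, f).
pose z N : S := N.+1%:R *: (yf N).1.
have bz : vN_bounded (range z).
  apply: null_sequence_bounded => N; exists N => n m k Nk nN mN.
  have [/(_ (@Ordinal k.+1 n (leq_trans nN Nk)))] := Hyf k.
  move=> /(_ (@Ordinal k.+1 m (leq_trans mN Nk)))/= + _ _.
  by move=> /lt_le_trans; apply; rewrite lee_fin lef_pV2 ?posrE// ler_nat ltnS.
have [r /gt0_complex[s s0 ->] Dr] := bD _ (near_strong_dual 0 bz ltr01).
have /gt0_complex[d d0 dE] := e0.
(* Then [N.+1 * d > s], whereas [D] is bounded by [s] at every [z N]. *)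
pose N := Num.truncn (s / d).
have [_ DN eN] := Hyf N.
have [|g /= g1 gE] := Dr (s%:C)%C _ _ DN.
  by rewrite normr_normc normc_real gtr0_norm.
have := g1 (z N) (ex_intro2 _ _ N I erefl).
rewrite /= sub0r normrN => gz.
have : `|val (yf N).2 (z N)| < (s%:C)%C.
  rewrite -gE [val _ _](_ : _ = (s%:C)%C * val g (z N))// normrM.
  rewrite [X in X * _]normr_normc normc_real (gtr0_norm s0).
  by rewrite -[ltRHS]mulr1 ltr_pM2l// ltcR.
rewrite strong_dualZ normrM normr_nat.
have : N.+1%:R * e <= N.+1%:R * `|val (yf N).2 (yf N).1|.
  by rewrite ler_wpM2l.
move=> /le_lt_trans/[apply]; rewrite dE -(rmorph_nat (real_complex R)).
rewrite -[_ * _](rmorphM (real_complex R)) ltcR -ltr_pdivlMr// ltNge.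
by rewrite ltW// truncnS_gt.
Qed.

End barrelled.

(** * The evaluation map and reflexivity *)

Section reflexivity.
Context {R : realType} {nu : R -> \bar R} {alpha : nat -> R}
  {eps : nat -> {posnum R}}.
Context (nu_admissible : admissible_profile nu)
  (alpha_dense : dense (range alpha))
  (eps_cvg0 : (eps m)%:num @[m --> \oo] --> (0 : R)).
Local Notation S := (Snu_space nu alpha eps).
Local Notation coord := (@coord R nu alpha eps nu_admissible alpha_dense
  eps_cvg0).
Local Notation form := (@form R nu alpha eps nu_admissible alpha_dense
  eps_cvg0).

Lemma bounded_polar (F : set (seq (R[i] * wavelet_index))) (B : set S) :
  (\forall x \near (0 : S), forall s, F s -> normc (pairing s (val x)) <= 1) ->
  vN_bounded B ->
  exists2 r : R, 0 < r & forall s x, F s -> B x -> `|val (form s)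
    x| <= (r%:C)%C.
Proof.
move=> nF bB; have [_ /gt0_complex[r r0 ->] Br] := bB _ nF.
exists r => // s x Fs Bx; have [|u uF <-] := Br (r%:C)%C _ x Bx.
  by rewrite normr_normc normc_real gtr0_norm.
rewrite strong_dualZ formE normrM [X in X * _]normr_normc normc_real (gtr0_norm
  r0).
rewrite -[leRHS]mulr1 ler_wpM2l//; first by rewrite lecR ltW.
by rewrite normr_normc lecR; exact: uF.
Qed.

(** Equicontinuous forms are uniformly bounded on each bounded [B], hence absorbed by each strong
    neighbourhood of 0. *)
Lemma polar_forms_bounded (F : set (seq (R[i] * wavelet_index))) :
  (\forall x \near (0 : S), forall s, F s -> normc (pairing s (val x)) <= 1) ->
  vN_bounded [set form s | s in F].
Proof.
move=> nF U /nbhs_strong_dual[B bB [e e0 BU]].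
have [r r0 Hr] := bounded_polar nF bB.
have rC : 0 < (r%:C)%C :> R[i] by rewrite ltcR.
(* The factor 2 makes the final inequality strict. *)
exists ((r%:C)%C / e * 2); first by rewrite !mulr_gt0// invr_gt0.
move=> t rt _ [s Fs <-].
have t0 : 0 < `|t| by rewrite (lt_le_trans _ rt)// !mulr_gt0// invr_gt0.
exists (t^-1 *: form s); last by rewrite scalerA divff ?scale1r// -normr_gt0.
apply: BU => x Bx; rewrite [val 0 x](_ : _ = 0)// sub0r normrN.
have -> : val (t^-1 *: form s) x = t^-1 * val (form s) x by [].
rewrite normrM normfV mulrC ltr_pdivrMr// (le_lt_trans (Hr s x Fs Bx))//.
have : e * ((r%:C)%C / e * 2) <= e * `|t| by rewrite ler_pM2l.
apply: lt_le_trans; rewrite mulrA [e * _]mulrC divfK ?gt_eqF//.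
by rewrite ltr_pMr// ltr1n.
Qed.

Lemma evaluation_continuous (x : S) : {for x, continuous (@evaluation R[i] S)}.
Proof.
move=> U /nbhs_strong_dual[D bD [e e0 DU]].
apply: filterS (near0_shift x (bounded_dual_equicontinuous nu_admissible
  alpha_dense eps_cvg0 bD e0)) => y Dy.
apply: DU => f Df; have := Dy f Df; rewrite strong_dualB distrC.
exact.
Qed.

Lemma evaluation_injective : injective (@evaluation R[i] S).
Proof.
move=> x y xy; apply/val_inj/funext => i.
by have /(congr1 (fun phi => val phi (coord i))) := xy.
Qed.

Lemma Snu_hausdorff : hausdorff_space S.
Proof.
move=> p q pq; apply/val_inj/funext => i; apply: contrapT => /eqP pqi.
have d0 : 0 < `|val p i - val q i| / 2 by rewrite divr_gt0// normr_gt0 subr_eq0.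
have near_coord_eq (y : S) : \forall z \near y, `|val y i - val z i| < `|val p
  i - val q i| / 2.
  by have /cvgrPdist_lt/(_ _ d0) := @strong_dual_continuous _ _ (coord i) y.
have [z [/= pz qz]] := pq _ _ (near_coord_eq p) (near_coord_eq q).
suff : `|val p i - val q i| < `|val p i - val q i| by rewrite ltxx.
apply: (le_lt_trans (ler_distD (val z i) _ _)).
by rewrite [ltRHS]splitr; apply: ltrD => //; rewrite distrC.
Qed.

Context (p01 : p0 nu = 1%E).

Lemma Snu_polar (U : set S) : nbhs 0 U ->
  exists2 F : set (seq (R[i] * wavelet_index)),
    (\forall x \near (0 : S), forall s, F s -> normc (pairing s (val x)) <= 1) &
    (forall x : S, (forall s, F s -> normc (pairing s (val x)) <= 1) -> U x).
Proof.
move=> /nbhs_Snu[N NU].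
have N0 : (0 : R) < N.+1%:R^-1 by rewrite invr_gt0.
have /choice[F HF] : forall nm : 'I_N.+1 * 'I_N.+1,
    exists F : set (seq (R[i] * wavelet_index)),
    (\forall x \near (0 : S), forall s, F s -> normc (pairing s (val x)) <= 1)
      /\
    (forall x : @Omega R, (forall s, F s -> normc (pairing s x) <= 1) ->
      (gauge (alpha nm.1) (nu (alpha nm.1) + (eps nm.2)%:num%:E)
        x < (N.+1%:R^-1)%:E)%E).
  move=> [n m]; have [F F1 F2] := @gauge_polar R nu alpha eps nu_admissible
    alpha_dense eps_cvg0 (alpha n) _ _ p01 (gt0 (eps m)) N0.
  by exists F.
exists (\bigcup_nm F nm).
  have H := @filter_forall S ('I_N.+1 * 'I_N.+1)%type _ _ (nbhs_filter (0 : S))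
    (fun nm => (HF nm).1).
  apply: filterS H => x xF s [nm _ Fs].
  exact: xF Fs.
move=> x xF; apply: NU => n m nN mN; rewrite sub0r gaugeN.
apply: (HF (@Ordinal N.+1 n nN, @Ordinal N.+1 m mN)).2 => s Fs.
by apply: xF; exists (@Ordinal N.+1 n nN, @Ordinal N.+1 m mN).
Qed.

Lemma evaluation_surjective (phi : strong_dual (strong_dual S)) :
  exists x : S, evaluation x = phi.
Proof.
pose x : @Omega R := fun i => val phi (coord i).
have phi_form s : val phi (form s) = pairing s x.
  rewrite /form /pairing; elim: s => [|q s IH].
    by rewrite !big_nil strong_dual0.
  by rewrite !big_cons strong_dual_linear IH.
have Sx : Snu nu x.
  apply: gauge_lty_Snu => // a e e0.
  have [F nF Fg] := gauge_polar nu_admissible alpha_dense eps_cvg0 a p01 e0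
    ltr01.
  have phi1 : \forall f \near (0 : strong_dual S), `|val phi f| < 1.
    have /cvgrPdist_lt/(_ 1 ltr01) := @strong_dual_continuous _ _ phi 0.
    by apply: filterS => f; rewrite strong_dual0 sub0r normrN.
  (* The forms of [F] are strongly bounded, so [phi] is bounded on them by some [M]; then
     [M^-1 *: x] meets the polar condition and has gauge below 1. *)
  have [_ /gt0_complex[M M0 ->] HM] := polar_forms_bounded nF phi1.
  have xF s : F s -> normc (pairing s x) <= M.
    move=> Fs; have [|g /= g1 gs] := HM (M%:C)%C _ _ (ex_intro2 _ _ s Fs erefl).
      by rewrite normr_normc normc_real gtr0_norm.
    rewrite -lecR -normr_normc -phi_form -gs strong_dualZ normrM.
    rewrite [X in X * _]normr_normc normc_real (gtr0_norm M0)
      -[leRHS]mulr1 ler_wpM2l ?(ltW g1)//.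
    by rewrite lecR ltW.
  have /Fg/gauge_lt_bound : forall s, F s -> normc (pairing s ((M^-1)%:C%C *:
    x)) <= 1.
    move=> s Fs; rewrite pairingZ normcM normc_real gtr0_norm ?invr_gt0//.
    by rewrite mulrC ler_pdivrMr// mul1r xF.
  move=> /(@gauge_boundZ R a _ (M%:C)%C _ 1 (Num.max 1 M)).
  rewrite le_max lexx => /(_ isT);
    rewrite normc_real gtr0_norm// le_max lexx orbT.
  rewrite scalerA -(rmorphM (real_complex R)) divff ?gt_eqF// rmorph1 scale1r.
  by move=> /(_ isT)/gauge_bound_gauge/le_lt_trans; apply; exact: ltry.
pose xS : S := exist (fun y => y \in Snu nu) x (mem_set Sx).
exists xS; apply/val_inj/funext => f /=.
(* [evaluation xS] and [phi] are continuous and agree on the dense set of all [form s]. *)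
apply/eqP; rewrite -subr_eq0; apply/negPn/negP => d0.
have e0 : 0 < `|val f xS - val phi f| / 2 by rewrite divr_gt0// normr_gt0.
have H1 : \forall g \near f, `|val f xS - val g xS| < `|val f xS - val phi f| /
  2.
  by have /cvgrPdist_lt/(_ _ e0) := @strong_dual_continuous _ _ (evaluation xS)
    f.
have H2 : \forall g \near f, `|val phi f - val phi g| < `|val f xS - val phi f|
  / 2.
  by have /cvgrPdist_lt/(_ _ e0) := @strong_dual_continuous _ _ phi f.
have [s [/= s1 s2]] := form_dense nu_admissible alpha_dense eps_cvg0 (filterI
  H1 H2).
move: s1 s2; rewrite phi_form formE /= => s1 s2.
suff : `|val f xS - val phi f| < `|val f xS - val phi f| by rewrite ltxx.
apply: (le_lt_trans (ler_distD (pairing s x) _ _)).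
by rewrite [ltRHS]splitr; apply: ltrD => //; rewrite distrC.
Qed.

(** The forms of [F] are strongly bounded, so uniform closeness on them defines a neighbourhood in
    the bidual, and by surjectivity its members are evaluations. *)
Lemma evaluation_open (A : set S) : open A -> open [set evaluation x | x in A].
Proof.
move=> oA; rewrite openE => _ [x Ax <-].
have [F nF FA] := Snu_polar (near_shift0 (open_nbhs_nbhs (conj oA Ax))).
apply: filterS (near_strong_dual (evaluation x) (polar_forms_bounded nF) ltr01)
  => psi Hpsi.
have [y yE] := evaluation_surjective psi; exists y => //.
rewrite -[y](subrKC x); apply: FA => s Fs.
have := Hpsi (form s) (ex_intro2 _ _ s Fs erefl).
by rewrite -yE /= !formE distrC -pairingB normr_normc ltcR => /ltW.
Qed.

Lemma Snu_locally_convex :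
  exists2 B : set_system S, (forall b, b \in B -> convex_set b) & basis B.
Proof.
exists [set V | open V /\ convex_set V]; first by move=> b /set_mem[].
split=> [V []//|x U Ux].
have [F nF FU] := Snu_polar (near_shift0 Ux).
(* [F] may be infinite: one bound [r < 1] common to all [s] is what makes [V] open. *)
pose V := [set y : S | exists2 r : R, r < 1 &
  forall s, F s -> normc (pairing s (val y - val x)) <= r].
exists V; last first.
  move=> y [r r1 yr]; rewrite -[y](subrKC x); apply: FU => s Fs.
  by apply: le_trans (ltW r1); exact: yr.
split; last by exists 0 => // s _;
  rewrite subrr -(scale0r 0) pairingZ mul0r normc0.
split.
  rewrite openE => y [r r1 yr].
  have r0 : 0 < (1 - r) / 2 by rewrite divr_gt0// subr_gt0.
  have := near0_shift y (nbhs0_scale (((1 - r) / 2)^-1%:C)%C nF).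
  apply: filterS => z zF; exists ((1 - r) / 2 + r); first by lra.
  move=> s Fs; rewrite -[val z](subrK (val y)) -addrA pairingD.
  apply: le_trans (le_normcD _ _) _; apply: lerD; last exact: yr.
  have := zF s Fs; rewrite pairingZ normcM normc_real gtr0_norm ?invr_gt0//.
  by rewrite mulrC ler_pdivrMr// mul1r.
move=> y z t /set_mem[r r1 yr] /set_mem[q q1 zq]; apply/mem_set.
exists (Num.max r q); first by rewrite gt_max r1.
move=> s Fs.
pose l : R[i] := t%:num.
have -> : val (conv t y z : S) - val x = l *: (val y - val x) + (1 - l)
  *: (val z - val x).
  rewrite !scalerBr addrACA -opprD -scalerDl addrCA subrr addr0 scale1r.
  by [].
have l0 : 0 <= l by rewrite /l ge0.
have l1 : 0 <= 1 - l by rewrite subr_ge0 /l le1.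
rewrite pairingD !pairingZ -lecR -normr_normc (le_trans (ler_normD _ _))//
  !normrM.
rewrite (ger0_norm l0) (ger0_norm l1).
have -> : (((Num.max r q)%:C)%C : R[i]) = l * ((Num.max r q)%:C)%C + (1 - l)
  * ((Num.max r q)%:C)%C.
  by rewrite -mulrDl addrC subrK mul1r.
apply: lerD; apply: ler_wpM2l => //; rewrite normr_normc lecR le_max.
  by rewrite yr.
by rewrite zq ?orbT.
Qed.

Lemma Snu_reflexive : reflexive_tvs S.
Proof.
split.
- split; [exact: Snu_hausdorff|exact: Snu_locally_convex].
- have /choice[g Hg] := evaluation_surjective.
  by exists g => // x; apply: evaluation_injective; exact: Hg.
- exact: evaluation_continuous.
- exact: evaluation_open.
Qed.

End reflexivity.

(** * Means of disjoint blocks *)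

Section averages_of_blocks.
Context {R : realType}.
Implicit Types (j m i : nat) (t u : R).

(** Each new mean is a convex combination of the previous mean and the new point, with weights
    [n.+1 / n.+2] and [1 / n.+2]. *)
Lemma convex_average (K : numFieldType) (V : lmodType K) (W : set V)
    (z : nat -> V) n : convex_set W -> (forall i, W (z i)) ->
  W (n.+1%:R^-1 *: \sum_(i < n.+1) z i).
Proof.
move=> cW Wz; elim: n => [|n IH]; first by rewrite big_ord1 invr1 scale1r.
have n2 : (n.+2%:R : K) != 0 by rewrite pnatr_eq0.
have t0 : 0 <= n.+1%:R / n.+2%:R :> K by rewrite divr_ge0.
have t1 : n.+1%:R / n.+2%:R <= 1 :> K by rewrite ler_pdivrMr// mul1r ler_nat.
have : W ((n.+1%:R / n.+2%:R) *: (n.+1%:R^-1 *: \sum_(i < n.+1) z i) +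
    (1 - n.+1%:R / n.+2%:R) *: z n.+1).
  exact: set_mem (cW _ _ (Itv01 t0 t1) (mem_set IH) (mem_set (Wz n.+1))).
rewrite scalerA mulrAC divff ?pnatr_eq0// mul1r.
have -> : 1 - n.+1%:R / n.+2%:R = n.+2%:R^-1 :> K.
  by rewrite -[X in X - _](divff n2) -mulrBl -natrB// subSnn mul1r.
by rewrite [\sum_(i < n.+2) _]big_ord_recr/= scalerDr.
Qed.

(** For [m > 0], the quotient by [m] cuts level [j] into runs of [m] consecutive positions, which
    are disjoint for distinct [i]. *)
Definition block j m i t : @Omega R :=
  fun l => if (tag l == j) && (tagged l %/ m == i)%N then (t%:C)%C else 0.

Lemma trunc_block j m i t : trunc j.+1 (block j m i t) = block j m i t.
Proof.
apply/funext => l; rewrite /trunc /block.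
by case: ifP => // lj; case: eqP => // lE; rewrite lE ltnSn in lj.
Qed.

Lemma block_count_le j j' m i t u : (0 < m)%N -> 0 < u ->
  (large_count (block j m i t) j' u <= m)%N.
Proof.
move=> m0 u0; rewrite -[leqRHS]card_ord.
(* In one block the quotient by [m] is fixed, so the remainder determines the position. *)
pose f (k : 'I_(2 ^ j')) : 'I_m := Ordinal (ltn_pmod k m0).
apply: (@leq_card_in _ _ f) => k l; rewrite !inE /block /=.
case: ifP => [/andP[_ /eqP ki] _|_]; last by rewrite normc0 leNgt u0.
case: ifP => [/andP[_ /eqP li] _|_]; last by rewrite normc0 leNgt u0.
move=> /(congr1 val)/= klm; apply/val_inj.
by rewrite /= (divn_eq k m) (divn_eq l m) ki li klm.
Qed.

Lemma block_count_eq0 j j' m i t u : 0 <= t -> 0 < u -> (j' = j -> t < u) ->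
  large_count (block j m i t) j' u = 0%N.
Proof.
move=> t0 u0 tu; apply: large_count_eq0 => k; rewrite /block.
case: eqP => [/tu tu'|_]; last by rewrite normc0.
by case: ifP => _; rewrite ?normc0// normc_real ger0_norm.
Qed.

(** If [a <= alpha], then [nu alpha >= s] and the block has few enough entries; if [alpha < a], its
    entries fall below the threshold. *)
Lemma near_block_gauge (nu : R -> \bar R) a s (alpha e c : R) :
  admissible_profile nu -> nu a = s%:E -> 0 < e -> 0 < c ->
  \forall j \near \oo, forall m i, (0 < m)%N -> m%:R <= 2 * 2 `^ (s * j%:R) ->
    (gauge alpha (nu alpha + e%:E) (block j m i (2 `^ (- a * j%:R))) < c%:E)%E.
Proof.
move=> nuA nua e0 c0; have c20 : 0 < c / 2 by rewrite divr_gt0.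
have cc : ((c / 2)%:E < c%:E)%E by rewrite lte_fin gtr_pMr// invf_lt1// ltr1n.
have [aalpha|alphaa] := leP a alpha.
  have [J _ HJ] := near_le_pow2 (2 / (c / 2)) e0.
  exists J => // j Jj m i m0 mj; apply: le_lt_trans cc.
  apply: gauge_bound_gauge; split=> [|j']; first exact: ltW.
  have [->|j'j] := eqVneq j' j; last first.
    rewrite block_count_eq0 ?powR_ge0 ?mulr_gt0 ?powR_gt0//.
      by rewrite mule_ge0 ?powe2_ge0// lee_fin ltW.
    by move=> /eqP; rewrite (negPf j'j).
  apply: (@le_trans _ _ m%:R%:E).
    by rewrite lee_fin ler_nat block_count_le ?mulr_gt0 ?powR_gt0.
  apply: (@le_trans _ _ ((c / 2)%:E * powe2 (nu a + e%:E) j)%E); last first.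
    apply: lee_wpmul2l; first by rewrite lee_fin ltW.
    by apply: powe2_le; rewrite leeD2r// profile_nondecreasing.
  rewrite nua /= -EFinM lee_fin (le_trans mj)//
    [(s + e) * _]mulrDl powRD ?pnatr_eq0 ?implybT//.
  rewrite mulrCA mulrC ler_wpM2l ?powR_ge0// mulrC -ler_pdivrMr//.
  exact: (HJ j Jj).
have da : 0 < a - alpha by rewrite subr_gt0.
have [J _ HJ] := near_le_pow2 (2 / (c / 2)) da.
exists J => // j Jj m i m0 mj; apply: le_lt_trans cc.
apply: gauge_bound_gauge; split=> [|j']; first exact: ltW.
rewrite block_count_eq0 ?powR_ge0 ?mulr_gt0 ?powR_gt0//.
  by rewrite mule_ge0 ?powe2_ge0// lee_fin ltW.
move=> ->; have := HJ j Jj; rewrite /= ler_pdivrMr// => H.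
have -> : - alpha * j%:R = (a - alpha) * j%:R + - a * j%:R by ring.
rewrite powRD ?pnatr_eq0 ?implybT// mulrA ltr_pMl ?powR_gt0//.
by rewrite mulrC (lt_le_trans _ H)// ltr1n.
Qed.

Lemma block_sum j m M t (k : 'I_(2 ^ j)) : (0 < m)%N -> (k < M * m)%N ->
  \sum_(i < M) block j m i t (existT _ j k) = (t%:C)%C.
Proof.
move=> m0 kM; have kmM : (k %/ m < M)%N by rewrite ltn_divLR.
rewrite (bigD1 (Ordinal kmM))//= big1 => [|i ik].
  by rewrite /block /= !eqxx addr0.
rewrite /block eqxx /=; case: eqP => // ki; case/eqP: ik; exact/val_inj.
Qed.

Lemma card_ord_lt (n p : nat) : (p <= n)%N -> #|[pred k : 'I_n | (k < p)%N]| =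
  p.
Proof.
move=> pn; have winj : injective (widen_ord pn) by move=>
  i k /(congr1 val)/= /val_inj.
rewrite -[RHS]card_ord -(card_imset _ winj).
apply: eq_card => k; rewrite !inE; apply/idP/imsetP => [kp|[i _ ->]];
  last exact: (ltn_ord i).
by exists (Ordinal kp) => //; exact/val_inj.
Qed.

End averages_of_blocks.

(** * Failure of local convexity when p_0 < 1 *)

Section not_locally_convex.
Context {R : realType} {nu : R -> \bar R} {alpha : nat -> R}
  {eps : nat -> {posnum R}}.
Context (nu_admissible : admissible_profile nu)
  (alpha_dense : dense (range alpha))
  (eps_cvg0 : (eps m)%:num @[m --> \oo] --> (0 : R)).
Local Notation S := (Snu_space nu alpha eps).

Lemma locally_convex_p0 : locally_convex_space S -> p0 nu = 1%E.
Proof.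
move=> [_ [BS cB [oB nB]]]; apply: contrapT =>
  /p0_lt1[a [s [p [nua s01 p1 slope]]]].
have [s0 s1] := andP s01.
(* The bound [h < 1 - s] leaves room on level [j] for all the blocks. *)
have [h /andP[h0 hs] nuh] : exists2 h, 0 < h < 1 - s & (nu (a + h)%R <= (s + p
  * h)%:E)%E.
  by apply: slope; rewrite subr_gt0.
pose q := Num.max p 0.
have q1 : q < 1 by rewrite gt_max p1 ltr01.
have pq : p <= q by rewrite le_max lexx.
have q0 : 0 <= q by rewrite le_max lexx orbT.
have qh1 : q * h < (q + 1) / 2 * h by rewrite ltr_pM2r//; lra.
have qh2 : (q + 1) / 2 * h < h by rewrite gtr_pMl//; lra.
(* So close to [a + h], [g = alpha n - a] exceeds [q * h], while monotonicity still gives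
   [nu (alpha n) <= s + q * h]. *)
have [n /andP[an nh]] : exists n, a + (q + 1) / 2 * h < alpha n < a + h.
  have [||y [/= yO [n _ nE]]] := @alpha_dense `](a + (q + 1)
    / 2 * h), (a + h)[%classic.
  - exists (a + ((q + 1) / 2 * h + h) / 2); rewrite /= in_itv/= !ltrD2l.
    by apply/andP; split; lra.
  - exact: interval_open.
  - by exists n; rewrite nE; move: yO; rewrite in_itv.
have d0 : 0 < (q + 1) / 2 * h - q * h by rewrite subr_gt0.
have [m0 em] : exists m, (eps m)%:num < (q + 1) / 2 * h - q * h.
  have /cvgr_lt/(_ _ d0) := eps_cvg0.
  by move=> /(@filter_ex _ _ _).
pose g := alpha n - a.
have qh0 : 0 <= q * h by rewrite mulr_ge0// ltW.
have g0 : 0 < g by rewrite /g; lra.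
have sg1 : 0 < 1 - (s + g) by rewrite /g; lra.
(* The exponent [s + g] of the count of the mean exceeds the one allowed by the gauge by at least
   [c]. *)
pose c := g - q * h - (eps m0)%:num.
have c0 : 0 < c by rewrite /c /g; lra.
have nun : (nu (alpha n) + (eps m0)%:num%:E <= (s + g - c)%:E)%E.
  have -> : s + g - c = s + q * h + (eps m0)%:num by rewrite /c; ring.
  rewrite [in leRHS]EFinD leeD2r//.
  apply: (@le_trans _ _ (s + p * h)%:E);
    last by rewrite lee_fin lerD2l ler_wpM2r// ltW.
  apply: le_trans nuh; apply: profile_nondecreasing => //; exact: ltW.
have [W [BW W0] WU] := nB 0 _ (@near_Snu R nu alpha eps 0 (n, m0) 1 ltr01).
have cW := cB W (mem_set BW).
have [N NW] := nbhs_Snu (open_nbhs_nbhs (conj (oB _ BW) W0)).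
have N0 : (0 : R) < N.+1%:R^-1 by rewrite invr_gt0.
have H : \forall j \near \oo, forall (n' m' : 'I_N.+1) m i, (0 < m)%N ->
    m%:R <= 2 * 2 `^ (s * j%:R) ->
    (gauge (alpha n') (nu (alpha n') + (eps m')%:num%:E)
      (block j m i (2 `^ (- a * j%:R))) < (N.+1%:R^-1)%:E)%E.
  apply: (@filter_forall nat 'I_N.+1) => n';
    apply: (@filter_forall nat 'I_N.+1) => m'.
  exact: near_block_gauge.
(* The factor 3 beats the 2 lost in rounding [G] down, the factor 2 covers rounding [P] up, and
   [1 <= G] ensures at least one block. *)
have [j [[[Hj Hc] Hs] Hg]] := filter_ex (filterI (filterI (filterI H
  (near_le_pow2 3 c0)) (near_le_pow2 2 sg1)) (near_le_pow2 1 g0)).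
pose G : R := 2 `^ (g * j%:R); pose P : R := 2 `^ (s * j%:R).
have P1 : 1 <= P.
  by rewrite -[leLHS](powRr0 2); apply: ler_powR; rewrite ?ler1n// mulr_ge0.
(* Rounding [G] down keeps the entries [2 ^ (- a j) / M.+1] of the mean at least
   [2 ^ (- alpha n * j)]; rounding [P] up gives blocks of at least [P] entries. *)
pose M := (Num.truncn G).-1; pose m := (Num.truncn P).+1.
have ME : M.+1 = Num.truncn G by rewrite prednK// truncn_gt0.
have MG : M.+1%:R <= G by rewrite ME truncn_le powR_ge0.
have GM : G <= 2 * M.+1%:R.
  have := truncnS_gt G; rewrite -ME -[M.+2]addn1 natrD => /ltW/le_trans; apply.
  by rewrite [leRHS]mulr_natl mulr2n lerD2l ler1n.
have Pm : P <= m%:R by rewrite ltW// truncnS_gt.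
have mP : m%:R <= 2 * P.
  rewrite /m -addn1 natrD [leRHS]mulr_natl mulr2n lerD//.
  by rewrite truncn_le powR_ge0.
have Mm : (M.+1 * m <= 2 ^ j)%N.
  rewrite -(ler_nat R) natrM natrX -powR_mulrn//.
  apply: (@le_trans _ _ (G * (2 * P))); first by rewrite ler_pM.
  rewrite mulrCA /G /P -powRD ?pnatr_eq0 ?implybT// -mulrDl.
  have -> : 2 `^ j%:R = 2 `^ ((1 - (s + g)) * j%:R) * 2 `^ ((g + s) * j%:R)
    :> R.
    by rewrite -powRD ?pnatr_eq0 ?implybT//; congr (_ `^ _); ring.
  by rewrite ler_wpM2r ?powR_ge0.
pose z i : S := Snu_trunc j.+1 (block j m i (2 `^ (- a * j%:R))).
have Wz i : W (z i).
  apply: NW => n' m' n'N m'N; rewrite sub0r gaugeN /= trunc_block.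
  exact: (Hj (@Ordinal N.+1 n' n'N) (@Ordinal N.+1 m' m'N)).
have := WU _ (convex_average M cW Wz).
rewrite sub0r gaugeN => /gauge_lt_bound[_ /(_ j)].
set y : @Omega R := val _.
have yE (k : 'I_(2 ^ j)) : (k < M.+1 * m)%N ->
    y (existT _ j k) = (M.+1%:R^-1 * 2 `^ (- a * j%:R))%:C%C.
  move=> kM; rewrite /y /=.
  have -> : (val (\sum_(i < M.+1) z i) : @Omega R)
      = \sum_(i < M.+1) block j m i (2 `^ (- a * j%:R)).
    rewrite raddf_sum; apply: eq_bigr => i _.
    exact: trunc_block.
  rewrite rmorphM fmorphV rmorph_nat; congr (_ * _).
  by rewrite fct_sumE block_sum.
have yn : (M.+1 * m <= large_count y j (1 * 2 `^ (- alpha n * j%:R)))%N.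
  rewrite -[leqLHS](card_ord_lt Mm); apply: subset_leq_card;
    apply/fintype.subsetP => k.
  rewrite !inE => kM; rewrite yE// normc_real ger0_norm ?mulr_ge0 ?powR_ge0//
    mul1r.
  have -> : - alpha n * j%:R = - (g * j%:R) + - a * j%:R by rewrite /g; ring.
  rewrite powRD ?pnatr_eq0 ?implybT// ler_wpM2r ?powR_ge0//.
  by rewrite powRN lef_pV2 ?posrE ?powR_gt0.
rewrite mul1e => /le_trans/(_ (powe2_le j nun)).
rewrite lee_fin leNgt => /negP; apply.
apply: (@lt_le_trans _ _ (M.+1 * m)%:R); last by rewrite ler_nat.
have -> : (s + g - c) * j%:R = s * j%:R + g * j%:R - c * j%:R by ring.
rewrite !powRD ?pnatr_eq0 ?implybT// -/P -/G powRN.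
rewrite ltr_pdivrMr ?powR_gt0// natrM.
have PG0 : 0 < P * G by rewrite mulr_gt0 ?powR_gt0.
apply: (@lt_le_trans _ _ (M.+1%:R * m%:R * 3)); last by rewrite ler_wpM2l.
have : P * G <= m%:R * (2 * M.+1%:R) by rewrite ler_pM ?powR_ge0.
by lra.
Qed.

End not_locally_convex.

Theorem corollary4p3 (R : realType) (nu : R -> \bar R)
    (alpha : nat -> R) (eps : nat -> {posnum R}) :
  admissible_profile nu ->
  dense (range alpha) ->
  nonincreasing_seq (fun m => (eps m)%:num) ->
  (eps m)%:num @[m --> \oo] --> (0 : R) ->
  reflexive_tvs (Snu_space nu alpha eps) <-> p0 nu = 1%E.
Proof.
move=> nuA dalpha _ eps0; split=> [[lcS _ _ _]|p01]; first exact: locally_convex_p0 lcS.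
exact: Snu_reflexive.
Qed.
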